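(* Let $\mathbb{T}=\mathbb{R}/\mathbb{Z}$, let $\alpha\in\mathbb{R}\setminus\mathbb{Q}$, let $T:\mathbb{T}^2\to\mathbb{T}^2$ be a hyperbolic toral automorphism, let $h:\mathbb{T}\to\mathbb{T}^2$ be continuous, and let $\Theta:\mathbb{T}\times\mathbb{T}^2\to\mathbb{T}\times\mathbb{T}^2$ be $\Theta(\omega,x)=(\theta\omega,F_\omega x)=(\omega+\alpha,\,Tx+h(\omega))$. Let $\varphi\in C(\mathbb{T}\times\mathbb{T}^2,\mathbb{R})$ and let $\mathbb{P}$ denote the Lebesgue measure on $\mathbb{T}$. Assume that $I_\varphi\neq\varnothing$. Then for $\mathbb{P}$-a.e. $\omega\in\mathbb{T}$: (1) $h_{top}(T,I_\varphi(\omega))=h_{top}(F)=h_{top}(\Theta)$; (2) $I_\varphi(\omega)$ is residual in $\mathbb{T}^2$.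
   Context: Irregular set: $I_\varphi=\{(\omega,x):\lim_{n\to\infty}\frac1n\sum_{i=0}^{n-1}\varphi(\Theta^i(\omega,x))\text{ does not exist}\}$ and $I_\varphi(\omega)=\{x\in\mathbb{T}^2:(\omega,x)\in I_\varphi\}$. A residual set is the complement of a set of first category. $h_{top}(\Theta)$ is the usual topological entropy of the homeomorphism $\Theta$ of the compact space $\mathbb{T}\times\mathbb{T}^2$. Bowen's topological entropy $h_{top}(T,Z)$ of $T$ on a (not necessarily compact or invariant) set $Z\subset\mathbb{T}^2$: put $d_n^T(x,y)=\max_{0\leq i\leq n-1}d_{\mathbb{T}^2}(T^ix,T^iy)$ and $B_n^T(x,\epsilon)=\{y:d_n^T(x,y)<\epsilon\}$. For $s\in\mathbb{R}$, $\epsilon>0$, $N\in\mathbb{N}$ let $m(Z,s,N,\epsilon)=\inf\sum_ie^{-sn_i}$ over all finite or countable covers $\{B^T_{n_i}(x_i,\epsilon)\}_i$ of $Z$ with $\min n_i\geq N$, and $m(Z,s,\epsilon)=\lim_{N\to\infty}m(Z,s,N,\epsilon)$. Let $h_{top}(T,Z,\epsilon)$ be the critical value of $s$ at which $m(Z,s,\epsilon)$ jumps from $+\infty$ to $0$; then $h_{top}(T,Z)=\lim_{\epsilon\to0}h_{top}(T,Z,\epsilon)$. Fiber topological entropy: with $F_\omega^n=F_{\theta^{n-1}\omega}\circ\cdots\circ F_\omega$ and $d_\omega^n(x,y)=\max_{0\leq i\leq n-1}d_{\mathbb{T}^2}(F_\omega^ix,F_\omega^iy)$, $h_{top}(F)=\lim_{\epsilon\to0}\limsup_{n\to\infty}\frac1n\int\log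 Z(\omega,\epsilon,n)\,d\mathbb{P}(\omega)$, where $Z(\omega,\epsilon,n)$ is the largest cardinality of a set $Q\subset\mathbb{T}^2$ with $d_\omega^n(x,y)>\epsilon$ for all distinct $x,y\in Q$. *)

(* Defs.v *)
From HB Require Import structures.
From mathcomp Require Import all_boot all_order all_algebra.
From mathcomp Require Import complex generic_quotient ring_quotient.
From mathcomp Require Import all_classical all_reals all_analysis.

Set Implicit Arguments.
Unset Strict Implicit.
Unset Printing Implicit Defensive.

Import Order.TTheory GRing.Theory Num.Theory.
Import numFieldNormedType.Exports.

Local Open Scope classical_set_scope.
Local Open Scope ring_scope.
Local Open Scope quotient_scope.

Definition integers (R : realType) : zmodClosed R :=
  GRing.ZmodClosed.clone R (@Num.int_num_subdef R) _.

(* R/Z; the class of a : R is [\pi_(circle R) a]. *)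
Definition circle (R : realType) : Type := {ideal_quot (integers R)}.

HB.instance Definition _ (R : realType) := GRing.Zmodule.on (circle R).
HB.instance Definition _ (R : realType) := Choice.on (circle R).
HB.instance Definition _ (R : realType) := EqQuotient.on (circle R).
HB.instance Definition _ (R : realType) := isPointed.Build (circle R) 0.

Section circle_metric.
Context {R : realType}.
Implicit Types (x y z : circle R) (a b : R).

Lemma circle_piE a b :
  (\pi_(circle R) a = \pi_(circle R) b) <-> (a - b \is a Num.int).
Proof.
split => [/eqP|] ab.
  by have := Quotient.idealrBE (integers R) a b; rewrite ab => ->.
by apply/eqP; have := Quotient.idealrBE (integers R) a b => <-.
Qed.

Lemma circle_piB a b :
  \pi_(circle R) (a - b) = \pi_(circle R) a - \pi_(circle R) b.
Proof. exact: (raddfB (\pi_(circle R))). Qed.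

Lemma circle_piD a b :
  \pi_(circle R) (a + b) = \pi_(circle R) a + \pi_(circle R) b.
Proof. exact: (raddfD (\pi_(circle R))). Qed.

Lemma circle_pi0 : \pi_(circle R) 0 = 0.
Proof. exact: (raddf0 (\pi_(circle R))). Qed.

Lemma circle_piN a : \pi_(circle R) (- a) = - \pi_(circle R) a.
Proof. exact: (raddfN (\pi_(circle R))). Qed.

(* The distance from 0 in R/Z, i.e. from a representative to Z. *)
Definition circle_norm x : R :=
  inf [set `|a| | a in [set a | \pi_(circle R) a = x]].

Let lbn x : has_lbound [set `|a| | a in [set a | \pi_(circle R) a = x]].
Proof. by exists 0 => _ [a _ <-]. Qed.

Let nen x : [set `|a| | a in [set a | \pi_(circle R) a = x]] !=set0.
Proof. by exists `|repr x|; exists (repr x) => //=; rewrite reprK. Qed.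

Lemma circle_norm_ge0 x : 0 <= circle_norm x.
Proof. by apply: lb_le_inf; first exact: nen; move=> _ [a _ <-]. Qed.

Lemma circle_norm_le a : circle_norm (\pi_(circle R) a) <= `|a|.
Proof. by apply: (ge_inf (lbn _)); exists a. Qed.

Lemma circle_norm_adherent x (e : R) : 0 < e ->
  exists2 a, \pi_(circle R) a = x & `|a| < circle_norm x + e.
Proof.
move=> e0; have hi : has_inf [set `|a| | a in [set a | \pi_(circle R) a = x]].
  by split; [exact: nen|exact: lbn].
by have [_ [a ax <-] ?] := inf_adherent e0 hi; exists a.
Qed.

Lemma circle_norm0 : circle_norm 0 = 0.
Proof.
apply/eqP; rewrite eq_le circle_norm_ge0 andbT.
by rewrite -circle_pi0 (le_trans (circle_norm_le _))// normr0.
Qed.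

Lemma circle_norm_eq0 x : circle_norm x = 0 -> x = 0.
Proof.
move=> x0.
have [a ax a1] := @circle_norm_adherent x 2^-1 (ltac:(by [])).
rewrite x0 add0r in a1.
have [a0|a0] := eqVneq a 0; first by rewrite -ax a0 circle_pi0.
have [b bx] := @circle_norm_adherent x `|a| (ltac:(by rewrite normr_gt0)).
rewrite x0 add0r => ba.
have /circle_piE abint : \pi_(circle R) a = \pi_(circle R) b by rewrite ax bx.
have ab1 : `|a - b| < 1.
  rewrite (le_lt_trans (ler_normB _ _))// [ltRHS](splitr 1) ltrD ?mul1r//.
  exact: lt_trans ba a1.
have [ab0|ab0] := eqVneq (a - b) 0.
  by move/eqP: ab0; rewrite subr_eq0 => /eqP ab; rewrite ab ltxx in ba.
by have := norm_intr_ge1 abint ab0; rewrite leNgt ab1.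
Qed.

Lemma circle_normN x : circle_norm (- x) = circle_norm x.
Proof.
suff H y : circle_norm (- y) <= circle_norm y.
  by apply/eqP; rewrite eq_le H/= -{1}(opprK x) H.
apply/ler_addgt0Pr => e /(circle_norm_adherent y)[a <- /ltW].
by apply: le_trans; rewrite -circle_piN (le_trans (circle_norm_le _))// normrN.
Qed.

Lemma circle_normD x y : circle_norm (x + y) <= circle_norm x + circle_norm y.
Proof.
apply/ler_addgt0Pr => e e0.
have e20 : 0 < e / 2 by rewrite divr_gt0.
have [a ax ae] := circle_norm_adherent x e20.
have [b bx be] := circle_norm_adherent y e20.
rewrite -{1}ax -{1}bx -circle_piD (le_trans (circle_norm_le _))//.
by rewrite (le_trans (ler_normD _ _))// (splitr e) addrACA lerD// ltW.
Qed.

Definition circle_dist x y : R := circle_norm (x - y).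

Let circle_distxx x : circle_dist x x = 0.
Proof. by rewrite /circle_dist subrr circle_norm0. Qed.

Let circle_dist_eq0 x y : circle_dist x y = 0 -> x = y.
Proof. by move=> /circle_norm_eq0/eqP; rewrite subr_eq0 => /eqP. Qed.

Let circle_dist_sym x y : circle_dist x y = circle_dist y x.
Proof. by rewrite /circle_dist -opprB circle_normN. Qed.

Let circle_dist_triangle y x z :
  circle_dist x z <= circle_dist x y + circle_dist y z.
Proof. by rewrite /circle_dist -(subrKA y) circle_normD. Qed.

HB.instance Definition _ := @isMetric.Build R (circle R) circle_dist
  circle_distxx circle_dist_eq0 circle_dist_sym circle_dist_triangle.

End circle_metric.

Section prod_metric.
Context {R : realType} {X Y : metricType R}.

Definition prod_dist (p q : X * Y) : R :=
  Num.max (mdist p.1 q.1) (mdist p.2 q.2).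

Let prod_dist_ge0 p q : 0 <= prod_dist p q.
Proof. by rewrite /prod_dist le_max mdist_ge0. Qed.

Let prod_dist_eq0 p q : prod_dist p q = 0 -> p = q.
Proof.
move: p q => [x y] [x' y'] h.
have : prod_dist (x, y) (x', y') <= 0 by rewrite h.
rewrite /prod_dist ge_max/= => /andP[h1 h2].
by congr pair; apply: mdist_positivity; apply/eqP; rewrite eq_le mdist_ge0 andbT.
Qed.

Let prod_ballE (p : X * Y) (e : R) : ball p e = [set q | prod_dist p q < e].
Proof.
apply/seteqP; split => q /=; rewrite /prod_dist gt_max.
  by move=> [] /=; rewrite !ballEmdist/= => -> ->.
by move=> /andP[? ?]; split; rewrite ballEmdist.
Qed.

HB.instance Definition _ := @PseudoMetric_isMetric.Build R (X * Y)%type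
  prod_dist prod_dist_ge0 prod_dist_eq0 prod_ballE.

End prod_metric.

Notation torus R := (circle R * circle R)%type.

(* The Borel sigma-algebra of R/Z. *)
HB.instance Definition _ (R : realType) :=
  @isMeasurable.Build (sigma_display (@open (circle R))) (circle R)
    <<s @open (circle R) >> (@sigma_algebra0 _ setT _) (@sigma_algebraC _ _)
    (@sigma_algebra_bigcup _ setT _).

Section circle_lebesgue.
Context {R : realType}.

Lemma continuous_circle_pi : continuous (\pi_(circle R) : R -> circle R).
Proof.
move=> a; apply/metricType_numDomainType.cvgrPdist_lt => e e0.
have : \forall t \near a, `|a - t| < e by move: (@cvg_id _ (nbhs a)) => /cvgrPdist_lt/(_ _ e0).
apply: filterS => t; apply: le_lt_trans.
by rewrite /mdist/= /circle_dist -circle_piB circle_norm_le.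
Qed.

Lemma measurable_circle_pi :
  measurable_fun [set: measurableTypeR R] (\pi_(circle R) : R -> circle R).
Proof.
apply: (@measurability _ _ (measurableTypeR R) (circle R) setT _ (@open (circle R)) erefl); move=> _ [U oU <-]; rewrite setTI.
by apply: (@measurable_realfun.open_measurable R); move/continuousP : continuous_circle_pi; exact.
Qed.

(* Lebesgue measure on R/Z: the image of Lebesgue measure on [0, 1[. *)
Definition circle_lebesgue : set (circle R) -> \bar R :=
  pushforward (mrestr (@lebesgue_measure R) (measurable_itv `[0, 1[))
    (\pi_(circle R) : measurableTypeR R -> circle R).

Let circle_lebesgue0 : circle_lebesgue set0 = 0%E.
Proof. by rewrite /circle_lebesgue /pushforward preimage_set0 measure0. Qed.

Let mrestr01 : {measure set (measurableTypeR R) -> \bar R} :=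
  mrestr (@lebesgue_measure R) (measurable_itv `[0, 1[).

Let circle_lebesgue_ge0 A : (0 <= circle_lebesgue A)%E.
Proof. exact: (measure_ge0 mrestr01). Qed.

Let circle_lebesgue_sigma_additive : semi_sigma_additive circle_lebesgue.
Proof.
move=> F mF tF mUF; rewrite /circle_lebesgue /pushforward preimage_bigcup.
have mp A : measurable A -> measurable
    ((\pi_(circle R) : measurableTypeR R -> circle R) @^-1` A).
  by move=> mA; rewrite -[X in measurable X]setTI; exact: measurable_circle_pi.
apply: (@measure_semi_sigma_additive _ _ _ mrestr01) => [n||].
- exact: mp.
- apply/trivIsetP => /= i j _ _ ij; rewrite -preimage_setI.
  by move/trivIsetP : tF => /(_ _ _ _ _ ij) ->//; rewrite preimage_set0.
- by rewrite -preimage_bigcup; exact: mp.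
Qed.

HB.instance Definition _ := isMeasure.Build _ _ _ circle_lebesgue
  circle_lebesgue0 circle_lebesgue_ge0 circle_lebesgue_sigma_additive.

Let circle_lebesgueT : circle_lebesgue [set: circle R] = 1%E.
Proof.
rewrite /circle_lebesgue /pushforward preimage_setT /mrestr setTI.
by rewrite lebesgue_measure_itv/= lte_fin ltr01 oppr0 adde0.
Qed.

HB.instance Definition _ := Measure_isProbability.Build _ _ _
  circle_lebesgue circle_lebesgueT.

End circle_lebesgue.

Section entropy.
Context {R : realType} {X : metricType R}.
Implicit Types (f : nat -> X -> X) (T : X -> X) (Z : set X).

(* The sequence f stands for the iterates of a map, or for the cocycle of a
   skew product over a fixed base point. *)
Definition bowen_dist f (n : nat) (x y : X) : R :=
  \big[Num.max/0]_(i < n) mdist (f i x) (f i y).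

Definition separated f (n : nat) (e : R) (Q : set X) :=
  forall x y, Q x -> Q y -> x <> y -> e < bowen_dist f n x y.

(* The largest cardinality of an (n, e)-separated set, +oo if unbounded. *)
Definition max_separated f (n : nat) (e : R) : \bar R :=
  ereal_sup [set k%:R%:E | k in
    [set k : nat | exists2 Q : set X, (Q #= `I_k)%card & separated f n e Q]].

Definition topological_entropy T : \bar R :=
  lim (limn_esup (fun n =>
    (n%:R^-1)%:E * lne (max_separated (fun i => iter i T) n e))%E @[e --> 0^'+]).

Definition bowen_ball T (n : nat) (x : X) (e : R) : set X :=
  [set y | bowen_dist (fun i => iter i T) n x y < e].

(* A finite or countable cover is indexed by an arbitrary set I of naturals. *)
Definition bowen_sum T Z (s : R) (N : nat) (e : R) : \bar R :=
  ereal_inf [set S | exists (I : set nat) (n : nat -> nat) (x : nat -> X),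
    [/\ (forall i, I i -> (N <= n i)%N),
        Z `<=` \bigcup_(i in I) bowen_ball T (n i) (x i) e
      & S = (\esum_(i in I) (expR (- (s * (n i)%:R)))%:E)%E]].

Definition bowen_measure T Z (s e : R) : \bar R :=
  limn (fun N => bowen_sum T Z s N e).

(* The critical value: s |-> bowen_measure T Z s e takes no value other than
   +oo before it and vanishes after it. *)
Definition bowen_entropy_at T Z (e : R) : \bar R :=
  ereal_inf [set s%:E | s in [set s : R | bowen_measure T Z s e = 0%E]].

Definition bowen_entropy T Z : \bar R :=
  lim (bowen_entropy_at T Z e @[e --> 0^'+]).

End entropy.

Section fiber_entropy.
Context {d : measure_display} {R : realType} {W : measurableType d}.
Context {X : metricType R}.

Fixpoint fiber_iter (theta : W -> W) (F : W -> X -> X) (w : W) (n : nat)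
    : X -> X :=
  if n is n'.+1 then F (iter n' theta w) \o fiber_iter theta F w n' else id.

Definition fiber_entropy (P : {measure set W -> \bar R}) (theta : W -> W)
    (F : W -> X -> X) : \bar R :=
  lim (limn_esup (fun n => (n%:R^-1)%:E *
    \int[P]_w lne (max_separated (fiber_iter theta F w) n e))%E @[e --> 0^'+]).

End fiber_entropy.

Definition irregular_set {R : realType} {X : Type} (T : X -> X) (phi : X -> R)
    : set X :=
  [set p | ~ cvgn (fun n => n%:R^-1 * \sum_(i < n) phi (iter i T p) : R)].

Section category.
Context {X : topologicalType}.

Definition nowhere_dense (A : set X) := interior (closure A) = set0.

Definition first_category (A : set X) :=
  exists2 F : nat -> set X,
    (forall n, nowhere_dense (F n)) & A = \bigcup_n F n.

Definition residual (A : set X) := first_category (~` A).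

End category.

Section skew_product.
Context {R : realType}.

Definition toral_map (A : 'M[int]_2) (x : torus R) : torus R :=
  (x.1 *~ A 0 0 + x.2 *~ A 0 1, x.1 *~ A 1 0 + x.2 *~ A 1 1).

Definition hyperbolic_toral_automorphism (T : torus R -> torus R) :=
  exists A : 'M[int]_2, [/\ A \in unitmx,
    (forall z : R[i], eigenvalue (map_mx intr A) z -> `|z| != 1)
    & T = toral_map A].

Definition rotation (alpha : R) (w : circle R) : circle R :=
  w + \pi_(circle R) alpha.

Definition fiber_map (T : torus R -> torus R) (h : circle R -> torus R)
    (w : circle R) (x : torus R) : torus R := T x + h w.

Definition skew_product (alpha : R) (T : torus R -> torus R)
    (h : circle R -> torus R) (p : circle R * torus R) : circle R * torus R :=
  (rotation alpha p.1, fiber_map T h p.1 p.2).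

End skew_product.

(* Main.v *)
Require Import Defs.
From HB Require Import structures.
From mathcomp Require Import all_boot all_order all_algebra.
From mathcomp Require Import complex generic_quotient zify ring lra.
From mathcomp Require Import all_classical all_reals all_analysis.
Import Order.TTheory GRing.Theory Num.Theory.
Import numFieldNormedType.Exports.
Local Open Scope classical_set_scope.
Local Open Scope ring_scope.
Local Open Scope quotient_scope.

(* The conclusion holds for every fiber. The maps F_w differ from T by
   translations, so a T-orbit segment shadows an F-orbit segment in any fiber
   once the starting point is translated, and separated sets for F and T are the
   same. A small perturbation of the cocycle is absorbed by a bounded solution of
   v(n+1) = T v(n) + e(n), hence a given orbit of Theta can be followed for ever
   from every nearby base point. Since the rotation is minimal with bounded
   return times, an oscillating orbit p of Theta yields, over every base point,
   points whose Birkhoff sums stay uniformly close to those of p.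

   Residuality follows by gluing such a point after an arbitrary initial point.
   For the entropy, long runs of freely chosen segments of length n0 from a
   separated set alternate with one segment that shadows p for a time comparable
   to that of the run. Were the averages to converge, so would the averages along
   the shadowing windows, whose lengths are chosen so that the averages of p at
   two successive ones differ. The free segments lose only O(1) time units per n0,
   and a cover by Bowen balls of the resulting points, coded by sequences of free
   choices, induces a cover of the sequence space by cylinders, whose total mass
   is at least 1. *)

Set Implicit Arguments.
Unset Strict Implicit.
Unset Printing Implicit Defensive.

(** * The torus and its norm *)

Section torus_norm.
Context {R : realType}.
Implicit Types x y z : torus R.

Definition torus_norm x : R := Num.max (circle_norm x.1) (circle_norm x.2).

Lemma torus_distE x y : mdist x y = torus_norm (x - y).
Proof. by []. Qed.

Lemma circle_distE (x y : circle R) : mdist x y = circle_norm (x - y).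
Proof. by []. Qed.

Lemma torus_norm_ge0 x : 0 <= torus_norm x.
Proof. by rewrite /torus_norm le_max circle_norm_ge0. Qed.

Lemma torus_norm_eq0 x : torus_norm x = 0 -> x = 0.
Proof.
move=> x0; suff: x = 0 :> torus R by [].
by apply/mdist_positivity; rewrite torus_distE subr0.
Qed.

Lemma torus_normN x : torus_norm (- x) = torus_norm x.
Proof. by rewrite /torus_norm/= !circle_normN. Qed.

Lemma torus_normD x y : torus_norm (x + y) <= torus_norm x + torus_norm y.
Proof.
rewrite /torus_norm ge_max; apply/andP; split;
  by rewrite (le_trans (circle_normD _ _))// lerD// le_max lexx ?orbT.
Qed.

Definition torus_line (e : R * R) (b : R) : torus R :=
  (\pi_(circle R) (b * e.1), \pi_(circle R) (b * e.2)).

Lemma torus_line_norm e b : `|e.1| <= 1 -> `|e.2| <= 1 ->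
  torus_norm (torus_line e b) <= `|b|.
Proof.
move=> e1 e2; rewrite /torus_norm ge_max !(le_trans (circle_norm_le _))//=;
  by rewrite normrM ler_piMr.
Qed.

Lemma torus_lineD e b c : torus_line e (b + c) = torus_line e b + torus_line e c.
Proof. by rewrite /torus_line !mulrDl !circle_piD. Qed.

Lemma torus_line0 e : torus_line e 0 = 0.
Proof. by rewrite /torus_line !mul0r !circle_pi0. Qed.

Lemma circle_piMz (a : R) (n : int) :
  \pi_(circle R) (a * n%:~R) = \pi_(circle R) a *~ n.
Proof. by rewrite mulrzr; exact: (raddfMz (\pi_(circle R))). Qed.

Lemma toral_mapD (A : 'M[int]_2) x y :
  toral_map A (x + y) = toral_map A x + toral_map A y.
Proof. by rewrite /toral_map/= !mulrzDl; congr pair => /=; rewrite addrACA. Qed.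

Lemma toral_map_comp (A B : 'M[int]_2) x :
  toral_map A (toral_map B x) = toral_map (A *m B) x.
Proof.
rewrite /toral_map/= !mxE !big_ord_recl !big_ord0 !addr0 /=.
have e1 : lift ord0 ord0 = 1 :> 'I_2 by apply/val_inj.
have e0 : ord0 = 0 :> 'I_2 by apply/val_inj.
rewrite !e1 !e0 !mulrzDr !mulrzDl -!mulrzA.
by congr pair; rewrite addrACA !(mulrC (A _ _)).
Qed.

Lemma toral_map1 x : toral_map (1%:M : 'M[int]_2) x = x.
Proof.
by case: x => x y; rewrite /toral_map !mxE /= !mulr0z !mulr1z addr0 add0r.
Qed.

Lemma torus_lift x (e : R) : 0 < e -> exists v : R * R,
  [/\ x = (\pi_(circle R) v.1, \pi_(circle R) v.2),
    `|v.1| < torus_norm x + e & `|v.2| < torus_norm x + e].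
Proof.
move=> e0; case: x => x y.
have [a ax ae] := circle_norm_adherent x e0.
have [b bx be] := circle_norm_adherent y e0.
exists (a, b); split => /=; first by rewrite ax bx.
- by apply: (lt_le_trans ae); rewrite lerD2r le_max lexx.
- by apply: (lt_le_trans be); rewrite lerD2r le_max lexx orbT.
Qed.

End torus_norm.

(** * Hyperbolic splitting *)

Lemma det_mx22 (K : comPzRingType) (A : 'M[K]_2) :
  \det A = A 0 0 * A 1 1 - A 0 1 * A 1 0.
Proof.
rewrite (expand_det_row _ 0) !big_ord_recl big_ord0 /cofactor !det_mx11 !mxE/=.
have e1 : lift ord0 ord0 = 1 :> 'I_2 by apply/val_inj.
have e0 : ord0 = 0 :> 'I_2 by apply/val_inj.
have e2 : lift (lift ord0 ord0) ord0 = 0 :> 'I_2 by apply/val_inj.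
rewrite !e2 !e1 !e0 /= addr0 expr0 mul1r.
by rewrite expr1 mulN1r mulrN.
Qed.

(** * Real eigenvalues of a hyperbolic integer matrix *)

Section eigenvalues.
Context {R : realType}.
Implicit Types A : 'M[int]_2.

Let eigenvalue_mx22 A (z : R[i]) :
  z ^+ 2 - (A 0 0 + A 1 1)%:~R * z + (\det A)%:~R = 0 ->
  A 1 0 != 0 -> eigenvalue (map_mx intr A) z.
Proof.
rewrite det_mx22 => zA c0; apply/eigenvalueP.
(* The row [(c, z - a)] is a left eigenvector of the matrix with rows [(a, b)] and [(c, d)], nonzero
   because [c] is. *)
exists (\row_j (if j == 0 then (A 1 0)%:~R else z - (A 0 0)%:~R)); last first.
  apply/eqP => /rowP/(_ 0); rewrite !mxE/= => /eqP; rewrite intr_eq0.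
  exact/negP.
apply/rowP => j; rewrite !mxE !big_ord_recl big_ord0 !mxE/=.
have e1 : lift ord0 ord0 = 1 :> 'I_2 by apply/val_inj.
have e0 : ord0 = 0 :> 'I_2 by apply/val_inj.
rewrite !e1 !e0 addr0.
have [->|j0] := eqVneq j 0; first by ring.
have -> : j = 1 by apply/val_inj; move: j j0 => [[|[|]]].
move: zA; rewrite !(intrD, intrB, intrM) => zA.
apply/eqP; rewrite -subr_eq0; apply/eqP; rewrite -[RHS]oppr0 -zA; ring.
Qed.


Let unit_det A : A \in unitmx -> \det A = 1 \/ \det A = -1.
Proof. by rewrite unitmxE => /orP[/eqP|/eqP]; [left|right]. Qed.

Let norm_factor (m n : int) : m * n = 1 \/ m * n = -1 -> `|m| = 1.
Proof.
move=> mn; have /orP[/eqP ->|/eqP ->]// : m \is a intUnitRing.unitz.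
by case: mn => mn; [apply: (@intUnitRing.unitzPl _ n)|
  apply: (@intUnitRing.unitzPl _ (- n))];
  rewrite ?mulNr mulrC mn ?opprK.
Qed.

Let norm_complexr (r : R) : `|r%:C%C| = `|r|%:C%C :> R[i].
Proof. by rewrite normc_def/= expr0n addr0 sqrtr_sqr. Qed.

Let norm_intrC (m : int) : `|m| = 1 -> `|m%:~R : R[i]| = 1.
Proof. by move=> m1; rewrite -intr_norm m1. Qed.

Let eigenvalue_row A (i : 'I_2) : (forall j, j != i -> A i j = 0) ->
  eigenvalue (map_mx intr A) ((A i i)%:~R : R[i]).
Proof.
move=> Ai0; apply/eigenvalueP; exists (delta_mx 0 i).
  rewrite -rowE; apply/rowP => j; rewrite !mxE eqxx/=.
  by have [->|/Ai0 ->] := eqVneq j i; rewrite ?mulr1 ?mulr0.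
by apply/eqP => /rowP/(_ i); rewrite !mxE !eqxx => /eqP; rewrite oner_eq0.
Qed.

(** A zero off-diagonal entry would make a diagonal entry, then equal to 1 or -1, an eigenvalue. A
    negative discriminant would force determinant 1 and conjugate roots of modulus 1. So both roots
    are real; the product of their moduli is 1 and neither modulus is 1. *)
Lemma hyperbolic_eigenvalues A : A \in unitmx ->
  (forall z : R[i], eigenvalue (map_mx intr A) z -> `|z| != 1) ->
  exists lam mu : R, [/\ lam + mu = (A 0 0 + A 1 1)%:~R,
    lam * mu = (\det A)%:~R, 1 < `|lam|, `|mu| < 1 & A 0 1 != 0].
Proof.
move=> /unit_det dA hyp.
have e1 : lift ord0 ord0 = 1 :> 'I_2 by apply/val_inj.
have e0 : ord0 = 0 :> 'I_2 by apply/val_inj.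
have j2 (j : 'I_2) : j = 0 \/ j = 1.
  by case: j => [[|[|//]]] j; [left|right]; apply/val_inj.
have c0 : A 1 0 != 0.
  apply/negP => /eqP c0; have A11 : `|A 1 1| = 1.
    apply: (@norm_factor _ (A 0 0)); move: dA.
    by rewrite det_mx22 c0 mulr0 subr0 mulrC.
  have := @eigenvalue_row A 1 => /(_ _)/hyp.
  rewrite norm_intrC// eqxx => H; apply: notF; apply: H => j.
  by have [->|->] := j2 j.
have b0 : A 0 1 != 0.
  apply/negP => /eqP b0; have A00 : `|A 0 0| = 1.
    by apply: (@norm_factor _ (A 1 1)); move: dA; rewrite det_mx22 b0 mul0r subr0.
  have := @eigenvalue_row A 0 => /(_ _)/hyp.
  rewrite norm_intrC// eqxx => H; apply: notF; apply: H => j.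
  by have [->|->] := j2 j.
have hypq z : z ^+ 2 - (A 0 0 + A 1 1)%:~R * z + (\det A)%:~R = 0 ->
    `|z : R[i]| != 1.
  by move=> zA; apply/hyp/eigenvalue_mx22.
set t : R := (A 0 0 + A 1 1)%:~R; set D : R := (\det A)%:~R.
have tC : (A 0 0 + A 1 1)%:~R = t%:C%C :> R[i] by rewrite rmorph_int.
have DC : (\det A)%:~R = D%:C%C :> R[i] by rewrite rmorph_int.
have hypr (r : R) : r ^+ 2 - t * r + D = 0 -> `|r| != 1.
  move=> rA; have := hypq r%:C%C; rewrite norm_complexr.
  rewrite tC DC => H; apply: contra (H _) => [/eqP ->//|].
  rewrite -[RHS]/(0%:C%C) -rA.
  by apply/eqP; rewrite eq_complex /= !expr2/=; apply/andP; split; apply/eqP; ring.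
have D1 : D = 1 \/ D = -1.
  by rewrite /D; case: dA => ->; [left|right]; rewrite ?mulrN1z.
have disc0 : 0 <= t ^+ 2 - 4 * D.
  rewrite leNgt; apply/negP => disc.
  have D1' : D = 1 by case: D1 => // D1; have := sqr_ge0 t; rewrite D1 in disc; lra.
  rewrite D1' in disc.
  have := hypq (t / 2 +i* (Num.sqrt (4 - t ^+ 2) / 2))%C.
  have s2 : Num.sqrt (4 - t ^+ 2) ^+ 2 = 4 - t ^+ 2 by rewrite sqr_sqrtr; lra.
  rewrite normc_def /= !expr_div_n s2 -mulrDl addrCA subrr addr0.
  have -> : 4 / 2 ^+ 2 = 1 :> R by field.
  rewrite sqrtr1 eqxx => H; apply: notF; apply: H.
  rewrite tC DC D1'.
  apply/eqP; rewrite eq_complex /= expr2/=; apply/andP; split; apply/eqP; nra.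
pose s := Num.sqrt (t ^+ 2 - 4 * D).
have s2 : s ^+ 2 = t ^+ 2 - 4 * D by rewrite sqr_sqrtr.
have r1 := hypr ((t + s) / 2); have r2 := hypr ((t - s) / 2).
have {}r1 : `|(t + s) / 2| != 1 by apply: r1; move: s2; rewrite !expr2 => s2; lra.
have {}r2 : `|(t - s) / 2| != 1 by apply: r2; move: s2; rewrite !expr2 => s2; lra.
have rr : (t + s) / 2 * ((t - s) / 2) = D by move: s2; rewrite !expr2 => s2; lra.
have nrr : `|(t + s) / 2| * `|(t - s) / 2| = 1.
  by rewrite -normrM rr; case: D1 => ->; rewrite ?normrN1 ?normr1.
case: (ltgtP `|(t + s) / 2| 1) r1 => // r1 _.
- exists ((t - s) / 2), ((t + s) / 2); split => //; [lra|by rewrite mulrC|].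
  rewrite ltNge; apply/negP => r2'; have := ler_piMr (normr_ge0 ((t + s) / 2)) r2'.
  by rewrite nrr leNgt r1.
- exists ((t + s) / 2), ((t - s) / 2); split => //; [lra|].
  rewrite ltNge; apply/negP => r2'; have := ler_peMr (normr_ge0 ((t + s) / 2)) r2'.
  by rewrite nrr leNgt r1.
Qed.
End eigenvalues.

(* [unstable] and [stable] parametrize the images in the torus of the two
   eigenlines of the matrix of T, by eigenvectors of sup norm at most 1. *)
Record splitting (R : realType) (T : torus R -> torus R) : Type := Splitting {
  expansion : R;
  contraction : R;
  unstable : R -> torus R;
  stable : R -> torus R;
  splitting_const : R;
  expansion_gt1 : 1 < `|expansion|;
  contraction_lt1 : `|contraction| < 1;
  unstable0 : unstable 0 = 0;
  unstableD : {morph unstable : b c / b + c};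
  stableD : {morph stable : b c / b + c};
  unstableE b : T (unstable b) = unstable (expansion * b);
  stableE b : T (stable b) = stable (contraction * b);
  unstable_norm b : torus_norm (unstable b) <= `|b|;
  stable_norm b : torus_norm (stable b) <= `|b|;
  splitting_const_ge0 : 0 <= splitting_const;
  splitting_coord x : exists p q : R, [/\ x = unstable p + stable q,
    `|p| <= splitting_const * torus_norm x &
    `|q| <= splitting_const * torus_norm x];
  splittingD : {morph T : x y / x + y};
  splitting_surj y : exists x, T x = y
}.

(** The eigenvector for an eigenvalue [nu] is [(b, nu - a)], with [b != 0]. The record lives in
    [Type], and the existential keeps the statement in [Prop]. *)
Lemma hyperbolic_splitting (R : realType) (T : torus R -> torus R) :
  hyperbolic_toral_automorphism T -> exists _ : splitting T, True.
Proof.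
case=> A [uA hyp ->].
have [lam [mu [sum prod lam1 mu1 b0]]] := hyperbolic_eigenvalues uA hyp.
move: prod; rewrite det_mx22 => prod.
pose a : R := (A 0 0)%:~R; pose b : R := (A 0 1)%:~R.
pose c : R := (A 1 0)%:~R; pose d : R := (A 1 1)%:~R.
have {}sum : lam + mu = a + d by rewrite sum intrD.
have {}prod : lam * mu = a * d - b * c by rewrite prod intrB !intrM.
have {}b0 : b != 0 by rewrite intr_eq0.
have lammu : lam - mu != 0.
  by apply/eqP => /subr0_eq lm; move: lam1; rewrite lm ltNge ltW.
(* [S] scales both eigenvectors to sup norm at most 1. *)
pose S := 1 + `|b| + `|lam - a| + `|mu - a|.
have S0 : 0 < S.
  by rewrite /S; have := normr_ge0 b; have := normr_ge0 (lam - a);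
     have := normr_ge0 (mu - a); lra.
pose e nu : R * R := (b / S, (nu - a) / S).
have e1 nu : `|(e nu).1| <= 1.
  rewrite /e/= normrM normfV (gtr0_norm S0) ler_pdivrMr// mul1r /S.
  by have := normr_ge0 (lam - a); have := normr_ge0 (mu - a); lra.
have el2 : `|(e lam).2| <= 1.
  rewrite /e/= normrM normfV (gtr0_norm S0) ler_pdivrMr// mul1r /S.
  by have := normr_ge0 b; have := normr_ge0 (mu - a); lra.
have em2 : `|(e mu).2| <= 1.
  rewrite /e/= normrM normfV (gtr0_norm S0) ler_pdivrMr// mul1r /S.
  by have := normr_ge0 b; have := normr_ge0 (lam - a); lra.
have eigen nu (x : R) : nu ^+ 2 = (a + d) * nu - (a * d - b * c) ->
    toral_map A (torus_line (e nu) x) = torus_line (e nu) (nu * x).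
  move=> nu2; rewrite /toral_map /torus_line/= -!circle_piMz -!circle_piD.
  rewrite -/a -/b -/c -/d; congr (\pi_(circle R) _, \pi_(circle R) _).
    by field; exact: lt0r_neq0.
  rewrite -!mulrA !(mulrC S^-1) !mulrA -mulrDl; congr (_ * _).
  have -> : nu * x * (nu - a) = x * (nu ^+ 2 - a * nu) by ring.
  by rewrite nu2; ring.
(* By Cramer's rule, a vector of sup norm at most [N] has coordinates at most [C * N] in the
   eigenbasis. *)
pose C := (S + S * `|(mu - a) / b| + S * `|(lam - a) / b|) / `|lam - mu|.
have C0 : 0 <= C by rewrite /C divr_ge0// !addr_ge0// ?mulr_ge0// ltW.
have coordE nu nu' (v : R * R) (N : R) : nu' = lam \/ nu' = mu ->
   `|nu| = `|lam - mu|^-1 -> `|v.1| <= N -> `|v.2| <= N ->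
   `|S * (v.2 - (nu' - a) / b * v.1) * nu| <= C * N.
  move=> nu'E nuE v1 v2; rewrite normrM nuE /C [leRHS]mulrAC.
  rewrite ler_pM2r ?invr_gt0 ?normr_gt0//.
  set x := `|(mu - a) / b|; set y := `|(lam - a) / b|.
  have -> : (S + S * x + S * y) * N = S * ((1 + x + y) * N) by ring.
  rewrite [leLHS]normrM (gtr0_norm S0) ler_pM2l// (le_trans (ler_normB _ _))//.
  rewrite [X in _ + X <= _]normrM.
  have N0 : 0 <= N by rewrite (le_trans _ v1).
  have := ler_wpM2l (normr_ge0 ((nu' - a) / b)) v1.
  have := mulr_ge0 (normr_ge0 ((lam - a) / b)) N0.
  have := mulr_ge0 (normr_ge0 ((mu - a) / b)) N0.
  by case: nu'E => ->; rewrite -/x -/y => ? ? ?; rewrite !mulrDl mul1r; lra.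
have lam2 : lam ^+ 2 = (a + d) * lam - (a * d - b * c).
  by rewrite -sum -prod; ring.
have mu2 : mu ^+ 2 = (a + d) * mu - (a * d - b * c).
  by rewrite -sum -prod; ring.
unshelve eexists (@Splitting R (toral_map A) lam mu
  (torus_line (e lam)) (torus_line (e mu)) (C * 2) lam1 mu1
  (torus_line0 _) (@torus_lineD _ _) (@torus_lineD _ _)
  (fun x => eigen _ x lam2) (fun x => eigen _ x mu2)
  _ _ _ _ (@toral_mapD _ _) _) => //.
- by move=> x; exact: torus_line_norm.
- by move=> x; exact: torus_line_norm.
- by rewrite mulr_ge0.
- move=> x.
  (* A point of positive norm lifts to a vector of norm less than twice its own, hence the constant
     [C * 2]; the strict bound excludes 0. *)
  have [x0|x0] := eqVneq (torus_norm x) 0.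
    exists 0, 0; rewrite !torus_line0 addr0 x0 mulr0 normr0; split => //.
    exact: torus_norm_eq0.
  have {}x0 : 0 < torus_norm x by rewrite lt0r x0 torus_norm_ge0.
  have [v [xv v1 v2]] := torus_lift x x0.
  exists (S * (v.2 - (mu - a) / b * v.1) * (lam - mu)^-1).
  exists (S * (v.2 - (lam - a) / b * v.1) * (mu - lam)^-1).
  rewrite -!mulrA (_ : 2 * _ = torus_norm x + torus_norm x); last by ring.
  rewrite !mulrA !coordE//; try exact: ltW; try by right.
  + split=> //; rewrite {1}xv /torus_line/=.
    have ml : mu - lam != 0 by rewrite -opprB oppr_eq0.
    have S1 := lt0r_neq0 S0.
    by apply: injective_projections; rewrite /= -circle_piD;
       congr (\pi_(circle R) _); field; rewrite ?b0 ?S1 ?ml ?lammu.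
  + by left.
  + by rewrite normfV distrC.
  + by rewrite normfV.
- move=> y; exists (toral_map (invmx A) y).
  by rewrite toral_map_comp mulmxV// toral_map1.
Qed.

(** * Shadowing and specification *)

Section contraction.
Context {R : realType}.

(** Solve the recurrence backwards from the value 0 at time [i + N]. As [N] grows the increments of
    these values are geometric, and their limit is a solution for all times. *)
Lemma backward_recurrence_bounded (k b : nat -> R) (kap B : R) :
  0 <= kap -> kap < 1 -> (forall i, `|k i| <= kap) -> (forall i, `|b i| <= B) ->
  exists P : nat -> R, forall i,
    P i = k i * P i.+1 + b i /\ `|P i| <= B / (1 - kap).
Proof.
move=> kap0 kap1 kkap bB.
pose fix back i N := if N is N'.+1 then k i * back i.+1 N' + b i else 0.
have B0 : 0 <= B by rewrite (le_trans (normr_ge0 (b 0%N))).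
have kap'0 : 0 < 1 - kap by rewrite subr_gt0.
have back_diff N i : `|back i N.+1 - back i N| <= B * kap ^+ N.
  elim: N i => [|N IH] i /=.
    by rewrite mulr0 add0r subr0 expr0 mulr1.
  rewrite opprD addrACA subrr addr0 -mulrBr normrM exprS mulrCA.
  by apply: ler_pM => //; exact: IH.
have back_bound N i : `|back i N| <= B / (1 - kap).
  elim: N i => [|N IH] i /=; first by rewrite normr0 divr_ge0 // ltW.
  rewrite (le_trans (ler_normD _ _))// normrM.
  have -> : B / (1 - kap) = kap * (B / (1 - kap)) + B by field; rewrite lt0r_neq0.
  by rewrite lerD// ler_pM.
have back_cvg i : cvgn (back i).
  have -> : back i = series (fun n => back i n.+1 - back i n).
    by apply/funext => n; rewrite /series/= telescope_sumr// subr0.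
  apply: normed_cvg; apply: (@series_le_cvg _ _ (geometric B kap)).
  - by move=> n; exact: normr_ge0.
  - by move=> n; rewrite /geometric/= mulr_ge0// exprn_ge0.
  - by move=> n; exact: back_diff.
  - by apply: is_cvg_geometric_series; rewrite ger0_norm.
exists (fun i => limn (back i)) => i; split.
  have c1 : (fun n => back i n.+1) @ \oo --> limn (back i).
    by rewrite (cvg_shiftS (back i)); exact: back_cvg.
  have c2 : (fun n => back i n.+1) @ \oo --> k i * limn (back i.+1) + b i.
    by apply: cvgD; [apply: cvgMr; exact: back_cvg|exact: cvg_cst].
  exact: (cvg_unique _ c1 c2).
have c : (fun n => `|back i n|) @ \oo --> `|limn (back i)|.
  by apply: cvg_norm; exact: back_cvg.
rewrite -(cvg_lim _ c)//; apply: limr_le; first by apply/cvg_ex; eexists; exact: c.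
by near=> n; exact: back_bound.
Unshelve. all: by end_near. Qed.

Lemma geometric_small (kap C e : R) : 0 <= kap -> kap < 1 -> 0 < e -> 
  exists N, (0 < N)%N /\ kap ^+ N * C <= e.
Proof.
move=> kap0 kap1 e0.
have c : (fun n => kap ^+ n * C) @ \oo --> (0 : R).
  rewrite -[X in _ --> X](mul0r C); apply: cvgMl.
  by apply: cvg_expr; rewrite ger0_norm.
have /cvgrPdist_le/(_ _ e0)[N _ NP] := c.
exists N.+1; split => //; have := NP N.+1 (leqnSn N).
by rewrite /= sub0r normrN; apply: le_trans; exact: ler_norm.
Qed.

End contraction.

Section shadowing.
Context {R : realType} {T : torus R -> torus R} (sp : splitting T).
Local Notation lam := (expansion sp).
Local Notation mu := (contraction sp).
Local Notation U := (unstable sp).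
Local Notation S := (stable sp).
Local Notation C := (splitting_const sp).

Let lam0 : 0 < `|lam|. Proof. exact: lt_trans ltr01 (expansion_gt1 sp). Qed.
Let lam_neq0 : lam != 0. Proof. by rewrite -normr_gt0 lam0. Qed.
Let lamV_ge0 : 0 <= `|lam|^-1. Proof. by rewrite invr_ge0. Qed.
Let lamV_lt1 : `|lam|^-1 < 1. Proof. by rewrite invf_lt1// expansion_gt1. Qed.

Let stable0 : S 0 = 0.
Proof. by apply: (addrI (S 0)); rewrite -stableD !addr0. Qed.

Lemma splittingB x y : T (x - y) = T x - T y.
Proof. by apply: (addIr (T y)); rewrite -(splittingD sp) !subrK. Qed.

Lemma iter_splittingD n x y : iter n T (x + y) = iter n T x + iter n T y.
Proof. by elim: n => //= n ->; rewrite (splittingD sp). Qed.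

Lemma iter_splittingB n x y : iter n T (x - y) = iter n T x - iter n T y.
Proof. by elim: n => //= n ->; rewrite splittingB. Qed.

Lemma iter_unstable n b : iter n T (U b) = U (lam ^+ n * b).
Proof. by elim: n => [|n IH]; rewrite ?expr0 ?mul1r//= IH unstableE exprS mulrA. Qed.

Lemma iter_stable n b : iter n T (S b) = S (mu ^+ n * b).
Proof. by elim: n => [|n IH]; rewrite ?expr0 ?mul1r//= IH stableE exprS mulrA. Qed.

Lemma iter_splitting_surj n y : exists x, iter n T x = y.
Proof.
elim: n y => [|n IH] y; first by exists y.
by have [x <-] := splitting_surj sp y; have [z <-] := IH x; exists z.
Qed.

(** The unstable coordinate is solved backwards in time and the stable one forwards from 0, so that
    both are bounded by geometric series. *)
Lemma pseudo_orbit_correction (eps : R) : 0 < eps -> exists2 del, 0 < del &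
  forall e : nat -> torus R, (forall i, torus_norm (e i) <= del) ->
  exists v : nat -> torus R, forall i,
    v i.+1 = T (v i) + e i /\ torus_norm (v i) <= eps.
Proof.
move=> eps0; have mu1 := contraction_lt1 sp; have C0 := splitting_const_ge0 sp.
pose K := (1 - `|lam|^-1)^-1 + (1 - `|mu|)^-1.
have K0 : 0 < K by rewrite addr_gt0// invr_gt0 subr_gt0.
have CK0 : 0 < (C + 1) * K by rewrite mulr_gt0// ltr_wpDl.
(* [K] adds the two geometric series; [C + 1] replaces [C] to keep the denominator positive. *)
exists (eps / ((C + 1) * K)); first by rewrite divr_gt0.
move=> e eP; set del := eps / _ in eP.
have del0 : 0 < del by rewrite divr_gt0.
have /choice[pq pqP] i : exists pq : R * R, [/\ e i = U pq.1 + S pq.2,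
    `|pq.1| <= C * del & `|pq.2| <= C * del].
  have [p [q [? pP qP]]] := splitting_coord sp (e i); exists (p, q); split => //.
  - by rewrite (le_trans pP)// ler_wpM2l.
  - by rewrite (le_trans qP)// ler_wpM2l.
have [||P PP] := @backward_recurrence_bounded _ (fun=> lam^-1)
    (fun i => - (lam^-1 * (pq i).1)) `|lam|^-1 (C * del) lamV_ge0 lamV_lt1.
- by move=> i; rewrite normfV.
- move=> i; rewrite normrN normrM normfV.
  have [_ + _] := pqP i; apply: le_trans.
  by rewrite ler_piMl// ltW.
pose fix Q i := if i is j.+1 then mu * Q j + (pq j).2 else 0.
have QP i : `|Q i| <= C * del / (1 - `|mu|).
  elim: i => [|i IH] /=.
    rewrite normr0; apply: divr_ge0; last by rewrite subr_ge0 ltW.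
    by rewrite mulr_ge0// ltW.
  rewrite (le_trans (ler_normD _ _))// normrM.
  have -> : C * del / (1 - `|mu|) = `|mu| * (C * del / (1 - `|mu|)) + C * del.
    by field; rewrite subr_eq0 gt_eqF.
  by rewrite lerD ?ler_wpM2l//; have [] := pqP i.
exists (fun i => U (P i) + S (Q i)) => i; split.
  rewrite (splittingD sp) unstableE stableE; have [-> _ _] := pqP i.
  rewrite addrACA -unstableD -stableD; congr (U _ + _).
  have [-> _] := PP i; rewrite mulrDr mulrN !mulrA divff// !mul1r; lra.
rewrite (le_trans (torus_normD _ _))//.
rewrite (le_trans (lerD (unstable_norm sp _) (stable_norm sp _)))//.
have [_ {}PP] := PP i; rewrite (le_trans (lerD PP (QP i)))// -mulrDr -/K.
have C1 : 0 < C + 1 by rewrite ltr_wpDl.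
have -> : C * del * K = eps * (C / (C + 1)).
  by rewrite /del; field; rewrite !lt0r_neq0.
by rewrite ler_piMr//; [exact: ltW|rewrite ler_pdivrMr// mul1r lerDl].
Qed.

(* [T ^ N] stretches a rectangle that covers the torus into a long thin one,
   which still covers the torus because [T ^ N] is onto. *)
Lemma stable_unstable_transition (del : R) : 0 < del ->
  exists2 M, (0 < M)%N & forall d, exists bq : R * R,
    [/\ `|bq.1| <= del, `|bq.2| <= del & d + U (lam ^+ M * bq.1) = S bq.2].
Proof.
move=> del0; have C0 := splitting_const_ge0 sp.
pose kap := Num.max `|lam|^-1 `|mu|.
have kap0 : 0 <= kap by rewrite le_max lamV_ge0.
have kap1 : kap < 1 by rewrite gt_max lamV_lt1 contraction_lt1.
have [N [N0 NP]] := @geometric_small _ kap C del kap0 kap1 del0.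
(* With [d = T^N (U p + S q)], the unstable part of [d] is [lam^N p]. A push of size [lam^-N p], at
   most [del], cancels it after [2N] steps; what remains is the stable part [mu^N q]. *)
exists (N + N)%N; first by rewrite addn_gt0 N0.
move=> d; have [d' d'E] := iter_splitting_surj N d.
have [p [q [d'pq pP qP]]] := splitting_coord sp d'.
have norm_le1 (x : torus R) : torus_norm x <= 1.
  have aux (y : circle R) : circle_norm y <= 1.
    rewrite -(reprK y); set r := repr y.
    have -> : \pi_(circle R) r = \pi_(circle R) (r - (Num.floor r)%:~R).
      by apply/circle_piE; rewrite opprB addrC subrK intr_int.
    rewrite (le_trans (circle_norm_le _))// ger0_norm ?subr_ge0 ?floor_le//.
    by rewrite lerBlDr addrC -[1]/(1%:~R) -intrD ltW// floorD1_gt.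
  by rewrite /torus_norm ge_max !aux.
have {}pP : `|p| <= C by rewrite (le_trans pP)// ler_piMr.
have {}qP : `|q| <= C by rewrite (le_trans qP)// ler_piMr.
exists (- (lam ^- N * p), mu ^+ N * q); split => /=.
- rewrite normrN normrM normfV normrX (le_trans _ NP)// ler_pM//.
  by rewrite -exprVn lerXn2r// ?nnegrE// le_max lexx.
- rewrite normrM normrX (le_trans _ NP)// ler_pM//.
  by rewrite lerXn2r// ?nnegrE// le_max lexx orbT.
- rewrite -d'E d'pq iter_splittingD iter_unstable iter_stable addrAC -unstableD.
  by rewrite mulrN mulrA exprD mulfK ?expf_neq0// subrr unstable0 add0r.
Qed.

Fixpoint start (n : nat -> nat) (M j : nat) : nat :=
  if j is j'.+1 then (start n M j' + n j' + M)%N else 0.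

(** [X j] follows the segments up to the j-th. At the end of segment [j] it is pushed along the
    unstable line so as to fall, [M] steps later, on the stable line through [z j.+1]. Seen from
    earlier times a push is exponentially small, so all of them can be made at once. *)
Lemma specification (eps : R) : 0 < eps -> exists2 M, (0 < M)%N &
  forall (z : nat -> torus R) (n : nat -> nat), exists x, forall j i,
    (i <= n j)%N ->
    torus_norm (iter (start n M j + i) T x - iter i T (z j)) <= eps.
Proof.
move=> eps0; pose K := 1 + (1 - `|lam|^-1)^-1.
have K0 : 0 < K by rewrite addr_gt0// invr_gt0 subr_gt0.
pose del := eps / K; have del0 : 0 < del by rewrite divr_gt0.
have [M M0 /choice[W WP]] := stable_unstable_transition del0.
exists M => // z n; pose sig j := (start n M j + n j)%N.
pose gap j x := iter M T (iter (sig j) T x) - z j.+1.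
pose fix X j := if j is j'.+1
  then X j' + U (lam ^- sig j' * (W (gap j' (X j'))).1) else z 0%N.
pose b j := (W (gap j (X j))).1.
have Xstart j : exists2 q, `|q| <= del & iter (start n M j) T (X j) = z j + S q.
  case: j => [|j]; first by exists 0; rewrite ?normr0 ?ltW//= stable0 addr0.
  have [_ qd WE] := WP (gap j (X j)); exists (W (gap j (X j))).2 => //.
  rewrite -WE /gap /= addrA -/(sig j) addnC iterD !iter_splittingD !iter_unstable.
  by rewrite mulVKf ?expf_neq0// [z _ + _]addrC subrK.
(* [P j] is the sum of all pushes from the j-th on, measured at the end of segment [j]. *)
have [||P PP] := @backward_recurrence_bounded _ (fun j => lam ^- (n j.+1 + M))
    b `|lam|^-1 del lamV_ge0 lamV_lt1.
- move=> j; rewrite normfV normrX -exprVn.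
  by rewrite -[leRHS]expr1 ler_wiXn2l// ?ltW// addn_gt0 M0 orbT.
- by move=> j; have [] := WP (gap j (X j)).
exists (X 0%N + U (lam ^- sig 0%N * P 0%N)).
(* The same point is described from every stage, so segment [j] can be checked with [X j]. *)
have xE j : X 0%N + U (lam ^- sig 0%N * P 0%N) = X j + U (lam ^- sig j * P j).
  elim: j => // j' ->; set j := j'; rewrite [X j.+1]/= -addrA -unstableD -/(b j).
  have [-> _] := PP j; congr (_ + U _).
  have -> : sig j.+1 = (sig j + (n j.+1 + M))%N by rewrite /sig /=; lia.
  set m := (n _ + M)%N.
  by rewrite exprD invfM mulrDr mulrA addrC.
move=> j i ij; rewrite (xE j) iter_splittingD iter_unstable addnC iterD.
have [q qd ->] := Xstart j; rewrite iter_splittingD iter_stable.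
rewrite -(addrA (iter i T (z j))) [iter i T (z j) + _]addrC addrK.
rewrite (le_trans (torus_normD _ _))//.
rewrite (le_trans (lerD (stable_norm sp _) (unstable_norm sp _)))//.
(* The first share bounds the stable error left by the previous push, the second the unstable error
   due to the pushes to come. *)
have -> : eps = del * 1 + del * (1 - `|lam|^-1)^-1.
  by rewrite -mulrDr -/K divfK// lt0r_neq0.
apply: lerD.
  rewrite mulr1 normrM normrX (le_trans _ qd)// ler_piMl// exprn_ile1//.
  by rewrite ltW// contraction_lt1.
have [_ {}PP] := PP j; rewrite mulrA normrM (le_trans _ PP)// ler_piMl//.
have -> : sig j = (i + start n M j + (n j - i))%N by rewrite /sig; lia.
rewrite [in X in _ * X]exprD invfM mulrA divff ?expf_neq0// mul1r.
by rewrite normfV normrX -exprVn exprn_ile1// ltW.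
Qed.

End shadowing.

(** * Uniform density of rotation orbits *)

Section compactness.
Context {R : realType}.

Lemma circle_compact : compact [set: circle R].
Proof.
have -> : [set: circle R] = [set \pi_(circle R) a | a in `[0, 1] : set R].
  apply/seteqP; split => // x _; exists (repr x - (Num.floor (repr x))%:~R).
    rewrite /= in_itv/= subr_ge0 floor_le lerBlDr addrC -[1]/(1%:~R) -intrD.
    by rewrite ltW// floorD1_gt.
  rewrite -[RHS]reprK; apply/circle_piE.
  by rewrite addrAC subrr add0r rpredN intr_int.
apply: continuous_compact; last exact: segment_compact.
by apply: continuous_subspaceT; exact: continuous_circle_pi.
Qed.

Lemma circle_torus_compact : compact [set: circle R * torus R].
Proof.
by rewrite -!setXTT; do 2?[apply: compact_setX => //]; exact: circle_compact.
Qed.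

(** Heine-Cantor theorem, by the near-covering form of compactness: each point takes care of a ball
    around it together with all small enough [d]. *)
Lemma compact_uniform_continuity (X : metricType R) (Y : pseudoMetricType R)
    (f : X -> Y) : compact [set: X] -> continuous f ->
  forall e, 0 < e -> exists2 d, 0 < d &
    forall x y, mdist x y < d -> ball (f x) e (f y).
Proof.
move=> /compact_near_coveringP cX cf e e0.
pose P (d : R) (x : X) := forall y, mdist x y < d -> ball (f x) e (f y).
have [d0 /= d00 d0P] : \forall d \near 0^'+, [set: X] `<=` P d.
  apply: cX => x _.
  have e20 : 0 < e / 2 by rewrite divr_gt0.
  have /cvg_ballP/(_ _ e20)/nbhs_ballP[r /= r0 rP] := cf x.
  exists (ball x (r / 2), [set d | 0 < d < r / 2]) => /=.
    split; first by apply: nbhsx_ballx; rewrite divr_gt0.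
    exists (r / 2) => /=; first by rewrite divr_gt0.
    by move=> d /=; rewrite sub0r normrN => + d0; rewrite d0 gtr0_norm.
  move=> [x' d] /= [xx' /andP[d0 dr]] y x'y.
  rewrite (splitr e); apply: (@ball_triangle _ _ (f x)).
    apply: ball_sym; apply: rP; apply: le_ball xx'.
    by rewrite ler_pdivrMr// ler_pMr// ler1n.
  apply: rP; rewrite (splitr r); apply: (ball_triangle xx').
  by rewrite ballEmdist/=; exact: lt_trans dr.
exists (d0 / 2); first by rewrite divr_gt0.
move=> x y xy; apply: (d0P (d0 / 2)) => //=; last by rewrite divr_gt0.
by rewrite sub0r normrN gtr0_norm ?divr_gt0// ltr_pdivrMr// ltr_pMr// ltr1n.
Qed.

End compactness.

Section rotation.
Context {R : realType} (alpha : R).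

Lemma iter_rotation j (w : circle R) :
  iter j (rotation alpha) w = w + \pi_(circle R) (j%:R * alpha).
Proof.
elim: j => [|j IH]; first by rewrite mul0r circle_pi0 addr0.
by rewrite iterS IH /rotation -addrA -circle_piD -[in RHS]natr1 mulrDl mul1r.
Qed.

(** Dirichlet's pigeonhole: among [m + 1] multiples of [alpha], two have fractional parts in the
    same box of width [1 / m], and irrationality keeps these parts distinct. *)
Let small_step (m : nat) : (0 < m)%N -> irrational alpha ->
  exists (q : nat) (beta : R),
  [/\ \pi_(circle R) beta = \pi_(circle R) (q%:R * alpha),
    beta != 0 & `|beta| < m%:R^-1].
Proof.
case: m => // m _ alphaI.
have m0 : 0 < m.+1%:R :> R by rewrite ltr0n.
pose fr (i : nat) : R := i%:R * alpha - (Num.floor (i%:R * alpha))%:~R.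
have fr0 i : 0 <= fr i by rewrite subr_ge0 floor_le.
have fr1 i : fr i < 1.
  by rewrite ltrBlDr addrC -[1]/(1%:~R) -intrD floorD1_gt.
pose box (i : 'I_m.+2) : 'I_m.+1 := inord (Num.truncn (m.+1%:R * fr i)).
have boxE i : (box i)%:R <= m.+1%:R * fr i < (box i).+1%:R.
  have mfr0 : 0 <= m.+1%:R * fr i by rewrite mulr_ge0// ltW.
  rewrite /box inordK ?truncn_itv// -(ltr_nat R).
  have /andP[+ _] := truncn_itv mfr0; move=> /le_lt_trans; apply.
  by rewrite -[ltRHS]mulr1 ltr_pM2l.
have /injectivePn[i [j ij bij]] : ~~ injectiveb box.
  by apply/negP => /injectiveP/leq_card; rewrite !card_ord ltnn.
wlog ltij : i j ij bij / (i < j)%N.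
  move=> H; have [?|] := ltnP i j; first exact: (H i j).
  by rewrite leq_eqVlt => /orP[/eqP/val_inj/esym/eqP|?];
    [rewrite (negbTE ij)|apply: (H j i) => //; rewrite eq_sym].
exists (j - i)%N, (fr j - fr i); split.
- apply/circle_piE; rewrite /fr natrB ?(ltnW ltij)//.
  rewrite (_ : _ - _ = (Num.floor (i%:R * alpha))%:~R -
    (Num.floor (j%:R * alpha))%:~R); last by ring.
  by rewrite rpredB// intr_int.
- apply/eqP => frij; apply: alphaI.
  exists ((Num.floor (j%:R * alpha) - Num.floor (i%:R * alpha))%:~R / (j - i)%:R) => //.
  rewrite rmorphM/= fmorphV/= ratr_int ratr_nat.
  have ji0 : (j - i)%:R != 0 :> R by rewrite pnatr_eq0 subn_eq0 -ltnNge.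
  apply: (mulIf ji0); rewrite divfK// natrB ?(ltnW ltij)// intrB.
  by move: frij; rewrite /fr => frij; lra.
- have := boxE i; have := boxE j; rewrite bij => /andP[j1 j2] /andP[i1 i2].
  rewrite -(ltr_pM2l m0) mulfV ?lt0r_neq0//.
  have -> : m.+1%:R * `|fr j - fr i| = `|m.+1%:R * (fr j - fr i)|.
    by rewrite normrM gtr0_norm.
  rewrite ltr_norml mulrBr; rewrite -natr1 in i2 j2; lra.
Qed.

(** Every [q] iterations rotate by the small step [beta], always in the same direction, so about
    [1 / |beta|] such steps go around the circle, whatever [w] and [w']. *)
Lemma rotation_uniformly_dense (del : R) : irrational alpha -> 0 < del ->
  exists J, forall w w' : circle R, exists2 j, (j <= J)%N &
    circle_norm (iter j (rotation alpha) w - w') < del.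
Proof.
move=> alphaI del0.
have [q [beta [bq b0 bd]]] := @small_step (Num.truncn del^-1).+1 isT alphaI.
have {}bd : `|beta| < del.
  apply: (lt_trans bd); rewrite -[ltRHS]invrK ltf_pV2 ?posrE ?invr_gt0//.
  have dV0 : 0 <= del^-1 by rewrite invr_ge0 ltW.
  by have /andP[] := truncn_itv dV0.
have nb0 : 0 < `|beta| by rewrite normr_gt0.
exists (q * (Num.truncn `|beta|^-1).+1)%N => w w'.
(* The representative [t] of [w' - w] gets the sign of [beta], so that the number of steps
   [t / beta] is nonnegative. *)
have [t [tw t1 tb]] : exists t,
    [/\ \pi_(circle R) t = w' - w, `|t| <= 1 & 0 <= t / beta].
  set s := repr (w' - w); pose t := s - (Num.floor s)%:~R.
  have t0 : 0 <= t by rewrite subr_ge0 floor_le.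
  have t1 : t <= 1 by rewrite lerBlDr addrC -[1]/(1%:~R) -intrD ltW// floorD1_gt.
  have tw : \pi_(circle R) t = w' - w.
    rewrite -[RHS]reprK; apply/circle_piE.
    by rewrite addrAC subrr add0r rpredN intr_int.
  have [bpos|bneg] := leP 0 beta.
    by exists t; split; rewrite ?ger0_norm// divr_ge0.
  exists (t - 1); split.
  - by rewrite -tw; apply/circle_piE; rewrite addrAC subrr add0r rpredN rpred1.
  - by rewrite ler0_norm ?subr_le0//; lra.
  - by rewrite mulr_le0 ?subr_le0// invr_le0 ltW.
pose i := Num.truncn (t / beta).
have /andP[i1 i2] := truncn_itv tb; rewrite -/i in i1 i2.
exists (q * i)%N.
  rewrite leq_mul2l; apply/orP; right; apply: ltnW; rewrite -(ltr_nat R).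
  apply: (le_lt_trans i1).
  have bV0 : 0 <= `|beta|^-1 by rewrite invr_ge0.
  have /andP[_] := truncn_itv bV0; apply: le_lt_trans.
  by rewrite (le_trans (ler_norm _))// normrM normfV ler_piMl.
rewrite iter_rotation mulnC natrM -mulrA.
have -> : \pi_(circle R) (i%:R * (q%:R * alpha)) = \pi_(circle R) (i%:R * beta).
  have H k (x : R) : \pi_(circle R) (k%:R * x) = \pi_(circle R) x *+ k.
    by rewrite mulr_natl; exact: (raddfMn (\pi_(circle R))).
  by rewrite (H i (_ * alpha)) (H i beta) bq.
rewrite addrAC -(opprB w') -tw addrC -circle_piB (le_lt_trans (circle_norm_le _))//.
have -> : i%:R * beta - t = (i%:R - t / beta) * beta by rewrite mulrBl divfK.
rewrite normrM (le_lt_trans _ bd)// ler_piMl// distrC ger0_norm ?subr_ge0//.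
by rewrite lerBlDr addrC natr1 ltW.
Qed.

End rotation.

(** * Birkhoff sums over nearby fibers *)

(** Otherwise, for each [e], a tail of [u] stays within [e] of a single term, which is a Cauchy
    criterion. The free index [n] lets any window be followed by one with a different average. *)
Lemma not_cvg_oscillation (R : realType) (u : nat -> R) : ~ cvgn u ->
  exists2 e, 0 < e & forall n N, exists2 m, (N <= m)%N & e <= `|u m - u n|.
Proof.
move=> ncu; apply: contrapT => nosc; apply: ncu; apply/cauchy_cvgP/cauchy_exP.
move=> e e0; apply: contrapT => ne; apply: nosc; exists e => // n N.
apply: contrapT => nm; apply: ne; exists (u n); exists N => // m /= Nm.
rewrite /ball/= distrC ltNge; apply/negP => um; apply: nm; by exists m.
Qed.

Section skew_product.
Context {R : realType} (alpha : R) (T : torus R -> torus R) (sp : splitting T).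
Context (h : circle R -> torus R) (phi : circle R * torus R -> R).
Context (alphaI : irrational alpha) (ch : continuous h) (cphi : continuous phi).
Local Notation rot := (rotation alpha).
Local Notation F := (fiber_map T h).
Local Notation Theta := (skew_product alpha T h).

Lemma fiber_iterB w n x y :
  fiber_iter rot F w n x - fiber_iter rot F w n y = iter n T (x - y).
Proof.
elim: n => //= n <-; rewrite /fiber_map (splittingB sp).
by rewrite opprD addrACA subrr addr0.
Qed.

Lemma iter_skew_product n p :
  iter n Theta p = (iter n rot p.1, fiber_iter rot F p.1 n p.2).
Proof. by elim: n => [|n IH]; [case: p|rewrite iterS IH]. Qed.

Lemma skew_product_dist n w x y :
  mdist (iter n Theta (w, x)) (iter n Theta (w, y)) = torus_norm (iter n T (x - y)).
Proof.
rewrite !iter_skew_product /= -[LHS]/(Num.max (mdist _ _) (mdist _ _)).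
by rewrite /= mdistxx torus_distE fiber_iterB max_r// torus_norm_ge0.
Qed.

(** The difference [v n] of the two orbits does not depend on [x]: it solves
    [v (n+1) = T (v n) + e n], where [e n] is a difference of values of [h]. The rotation is an
    isometry, so uniform continuity keeps every [e n] small. *)
Lemma fiber_stability (eps : R) : 0 < eps -> exists2 del, 0 < del &
  forall w w' : circle R, circle_norm (w - w') < del -> exists v, forall n x,
    mdist (fiber_iter rot F w n x) (fiber_iter rot F w' n (x - v)) <= eps.
Proof.
move=> eps0; have [d d0 dP] := pseudo_orbit_correction sp eps0.
have [del del0 delP] := compact_uniform_continuity circle_compact ch d0.
exists del => // w w' ww'.
have [i|v vP] := dP (fun i => h (iter i rot w) - h (iter i rot w')).
  apply: ltW; have := delP (iter i rot w) (iter i rot w').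
  rewrite ballEmdist/= torus_distE; apply.
  by rewrite circle_distE !iter_rotation opprD addrACA subrr addr0.
exists (v 0%N) => n x.
have -> : mdist (fiber_iter rot F w n x)
    (fiber_iter rot F w' n (x - v 0%N)) = torus_norm (v n).
  rewrite torus_distE; congr torus_norm; elim: n => [|n IH] /=.
    by rewrite opprB addrC subrK.
  have [-> _] := vP n; rewrite -IH /fiber_map (splittingB sp).
  by rewrite opprD addrACA.
by have [] := vP n.
Qed.

Definition birkhoff_sum n p : R := \sum_(i < n) phi (iter i Theta p).

Lemma birkhoff_sumD m n p :
  birkhoff_sum (m + n) p = birkhoff_sum m p + birkhoff_sum n (iter m Theta p).
Proof.
rewrite /birkhoff_sum big_split_ord/=; congr (_ + _).
by apply: eq_bigr => i _; rewrite addnC iterD.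
Qed.

Lemma birkhoff_sum_shadow (kap : R) : 0 < kap -> exists2 eps, 0 < eps &
  forall n p p', (forall i, (i < n)%N ->
    mdist (iter i Theta p) (iter i Theta p') <= eps) ->
  `|birkhoff_sum n p - birkhoff_sum n p'| <= kap * n%:R.
Proof.
move=> kap0.
have [d d0 dP] := compact_uniform_continuity circle_torus_compact cphi kap0.
exists (d / 2); first by rewrite divr_gt0.
move=> n p p' pp'; rewrite /birkhoff_sum -sumrB (le_trans (ler_norm_sum _ _ _))//.
have -> : kap * n%:R = \sum_(i < n) kap by rewrite sumr_const card_ord mulr_natr.
apply: ler_sum => i _; apply/ltW.
apply: (dP (iter i Theta p) (iter i Theta p')).
by rewrite (le_lt_trans (pp' i _))// ltr_pdivrMr// ltr_pMr// ltr1n.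
Qed.

Lemma birkhoff_sum_bound : exists2 B, 0 <= B &
  forall n p, `|birkhoff_sum n p| <= B * n%:R.
Proof.
have [B B0 BP] : exists2 B, 0 <= B & forall p, `|phi p| <= B.
  have : compact [set phi p | p in [set: circle R * torus R]].
    apply: continuous_compact; last exact: circle_torus_compact.
    exact: continuous_subspaceT.
  move/(@compact_bounded _ R^o) => -[B [Breal BP]].
  exists (`|B| + 1); first by rewrite addr_ge0.
  by move=> p; apply: BP; [rewrite (le_lt_trans (ler_norm _))// ltrDl|exists p].
exists B => // n p; rewrite /birkhoff_sum (le_trans (ler_norm_sum _ _ _))//.
have -> : B * n%:R = \sum_(i < n) B by rewrite sumr_const card_ord mulr_natr.
exact: ler_sum.
Qed.

(** At some time [j <= J] the orbit of [p] passes over a point close to [w], and from there it can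
    be followed for ever in the fibers along the orbit of [w]. *)
Lemma birkhoff_sum_transport p (kap : R) : 0 < kap -> exists2 C, 0 <= C &
  forall w, exists z, forall n,
    `|birkhoff_sum n (w, z) - birkhoff_sum n p| <= kap * n%:R + C.
Proof.
move=> kap0; have [eps eps0 epsP] := birkhoff_sum_shadow kap0.
have [d d0 dP] := fiber_stability eps0.
have m0 : 0 < Num.min d eps by rewrite lt_min d0.
have [J JP] := rotation_uniformly_dense alphaI m0.
have [B B0 BP] := birkhoff_sum_bound.
(* Starting the sum at time [j] rather than 0 changes it by two sums of length [j], one at each
   end. *)
exists (B * J%:R + B * J%:R); first by rewrite addr_ge0// mulr_ge0.
move=> w; have [j jJ] := JP p.1 w.
rewrite lt_min => /andP[jd je].
have [v vP] := dP _ _ jd; pose x := fiber_iter rot F p.1 j p.2.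
exists (x - v) => n; have jE : iter j Theta p = (iter j rot p.1, x).
  by rewrite iter_skew_product.
have : `|birkhoff_sum n (iter j Theta p) - birkhoff_sum n (w, x - v)| <= kap * n%:R.
  apply: epsP => i _; rewrite jE !iter_skew_product /=.
  rewrite -[leLHS]/(Num.max (mdist _ _) (mdist _ _)) /= ge_max vP andbT.
  by rewrite circle_distE !(iter_rotation _ i) opprD addrACA subrr addr0 ltW.
rewrite distrC; have := birkhoff_sumD n j p; rewrite addnC birkhoff_sumD => nj kn.
have -> : birkhoff_sum n (w, x - v) - birkhoff_sum n p =
  (birkhoff_sum n (w, x - v) - birkhoff_sum n (iter j Theta p)) +
  (birkhoff_sum j (iter n Theta p) - birkhoff_sum j p).
  by move: nj; lra.
rewrite (le_trans (ler_normD _ _))// lerD// (le_trans (ler_normB _ _))//.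
by rewrite lerD// (le_trans (BP _ _))// ler_wpM2l// ler_nat.
Qed.

End skew_product.

(** * Residuality of irregular fibers *)

Lemma natr_dominates (R : realType) (C kap : R) : 0 < kap ->
  exists N, (0 < N)%N /\ forall n, (N <= n)%N -> C <= kap * n%:R.
Proof.
move=> kap0; exists (Num.truncn (`|C| / kap)).+1; split => // n Nn.
have Ck : 0 <= `|C| / kap by rewrite divr_ge0// ltW.
have /andP[_ Ci] := truncn_itv Ck.
rewrite (le_trans (ler_norm _))// mulrC -ler_pdivrMr// (le_trans (ltW Ci))//.
by rewrite ler_nat.
Qed.

Section irregular.
Context {R : realType} (alpha : R) (T : torus R -> torus R) (sp : splitting T).
Context (h : circle R -> torus R) (phi : circle R * torus R -> R).
Context (alphaI : irrational alpha) (ch : continuous h) (cphi : continuous phi).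
Local Notation rot := (rotation alpha).
Local Notation F := (fiber_map T h).
Local Notation Theta := (skew_product alpha T h).
Local Notation Phi := (birkhoff_sum alpha T h phi).

(* Subtracting the cocycle turns shadowing by F in the fibers into shadowing
   by the single map T. *)
Lemma birkhoff_sum_target p (kap : R) : 0 < kap -> exists2 eps, 0 < eps &
  exists2 C, 0 <= C & forall w s, exists z, forall x n,
    (forall i, (i < n)%N -> torus_norm (iter (s + i) T x - iter i T z) <= eps) ->
    `|Phi n (iter s Theta (w, x)) - Phi n p| <= kap * n%:R + C.
Proof.
move=> kap0; have kap20 : 0 < kap / 2 by rewrite divr_gt0.
have [eps eps0 epsP] := birkhoff_sum_shadow alpha T h cphi kap20.
have [C C0 CP] := birkhoff_sum_transport sp alphaI ch cphi p kap20.
exists eps => //; exists C => // w s.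
have [z zP] := CP (iter s rot w).
exists (z - fiber_iter rot F w s 0) => x n xz.
have -> : kap * n%:R + C = kap / 2 * n%:R + (kap / 2 * n%:R + C) by lra.
rewrite (le_trans (ler_distD (Phi n (iter s rot w, z)) _ _))// lerD//.
apply: epsP => i ni; rewrite (iter_skew_product _ _ _ s) (skew_product_dist _ sp).
have -> : fiber_iter rot F w s x = iter s T x + fiber_iter rot F w s 0.
  by have := fiber_iterB alpha sp h w s x 0; rewrite subr0 => <-; rewrite subrK.
rewrite /= -addrA -(opprB z) (iter_splittingB sp) -iterD addnC.
exact: xz.
Qed.

Lemma average_shift q B s n :
  (forall n q, `|Phi n q| <= B * n%:R) -> (0 < n)%N ->
  `|(s + n)%:R^-1 * Phi (s + n) q - n%:R^-1 * Phi n (iter s Theta q)|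
    <= 2 * B * s%:R / n%:R.
Proof.
move=> BP n0; rewrite birkhoff_sumD.
set a := Phi s q; set b := Phi n _.
have n0' : 0 < n%:R :> R by rewrite ltr0n.
have sn0 : 0 < (s + n)%:R :> R by rewrite ltr0n addn_gt0 n0 orbT.
have -> : (s + n)%:R^-1 * (a + b) - n%:R^-1 * b =
    (a - s%:R * (n%:R^-1 * b)) / (s + n)%:R.
  have -> : (s + n)%:R = s%:R + n%:R :> R by rewrite natrD.
  by field; rewrite -natrD !lt0r_neq0.
have aB : `|a| <= B * s%:R by exact: BP.
have bB : `|n%:R^-1 * b| <= B.
  by rewrite normrM ger0_norm ?invr_ge0// mulrC ler_pdivrMr//; exact: BP.
have B0 : 0 <= B by rewrite (le_trans _ bB).
rewrite normrM [X in _ * X]ger0_norm ?invr_ge0// ler_pM ?invr_ge0//.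
  rewrite (le_trans (ler_normB _ _))// normrM [X in _ + X * _]ger0_norm//.
  by have := ler_wpM2l (ler0n R s) bB; lra.
by rewrite lef_pV2 ?posrE// ler_nat leq_addl.
Qed.

Lemma splitting_lipschitz n : exists2 K, 0 < K &
  forall x, torus_norm (iter n T x) <= K * torus_norm x.
Proof.
have [K K0 KP] : exists2 K, 0 < K & forall x, torus_norm (T x) <= K * torus_norm x.
  have C0 := splitting_const_ge0 sp; set C := splitting_const sp in C0.
  exists (`|expansion sp| * C + `|contraction sp| * C + 1).
    by rewrite ltr_wpDl// addr_ge0// mulr_ge0.
  move=> x; have [p [q [xE pP qP]]] := splitting_coord sp x.
  rewrite [X in T X]xE (splittingD sp) unstableE stableE.
  rewrite (le_trans (torus_normD _ _))//.
  rewrite (le_trans (lerD (unstable_norm sp _) (stable_norm sp _)))// !normrM.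
  have := ler_wpM2l (normr_ge0 (expansion sp)) pP.
  have := ler_wpM2l (normr_ge0 (contraction sp)) qP.
  by have := torus_norm_ge0 x; rewrite -/C; lra.
exists (K ^+ n); first by rewrite exprn_gt0.
elim: n => [|n IH] x; first by rewrite expr0 mul1r.
by rewrite iterS (le_trans (KP _))// exprS -mulrA ler_wpM2l// ltW.
Qed.

Lemma birkhoff_sum_fiber_continuous w n : continuous (fun x => Phi n (w, x)).
Proof.
move=> x; rewrite /birkhoff_sum; apply: cvg_big => [|i _].
  exact: (@add_continuous R^o).
have : {for x, continuous (fun y => iter i Theta (w, y))}.
  have [K K0 KP] := splitting_lipschitz i.
  apply/metricType_numDomainType.cvgrPdist_lt => e e0; near=> y.
  rewrite (skew_product_dist _ sp) (le_lt_trans (KP _))// mulrC -ltr_pdivlMr//.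
  rewrite -torus_distE; near: y.
  have eK : 0 < e / K by rewrite divr_gt0.
  by have /metricType_numDomainType.cvgrPdist_lt/(_ _ eK) := @cvg_id _ (nbhs x).
by move=> /continuous_comp; apply; exact: cphi.
Unshelve. all: by end_near. Qed.

(** The irregular fiber contains the intersection of the sets [V N]. These are open by continuity of
    finite averages and dense by specification: after any initial point one can glue a point whose
    averages oscillate like those of [p]. *)
Lemma irregular_fiber_residual w : irregular_set Theta phi !=set0 ->
  residual [set x | irregular_set Theta phi (w, x)].
Proof.
move=> [p] /not_cvg_oscillation[e0 e00 osc].
pose A n x : R := n%:R^-1 * Phi n (w, x).
pose V N := [set x | exists n m,
  [/\ (N <= n)%N, (N <= m)%N & e0 / 4 < `|A m x - A n x|]].
set Irr := [set x | _].
have VIrr : \bigcap_N V N `<=` Irr.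
  move=> x Vx /= cA.
  have e08 : 0 < e0 / 8 by rewrite divr_gt0.
  have /cvgrPdist_lt/(_ _ e08)[N _ NP] := cA.
  have [n [m [Nn Nm]]] := Vx N I; apply/negP; rewrite -leNgt.
  have := NP n Nn; have := NP m Nm; rewrite /= -/(Phi n (w, x)) -/(Phi m (w, x)).
  rewrite -/(A n x) -/(A m x) => m8 n8.
  set l := lim _ in m8 n8.
  have -> : A m x - A n x = (l - A n x) - (l - A m x) by lra.
  by rewrite (le_trans (ler_normB _ _))//; lra.
have oV N : open (V N).
  have -> : V N = \bigcup_(nm in [set nm : nat * nat |
      (N <= nm.1)%N /\ (N <= nm.2)%N])
      [set x | e0 / 4 < `|A nm.2 x - A nm.1 x|].
    apply/seteqP; split => x /= [n]; first by move=> [m [Nn Nm nm]]; exists (n, m).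
    by case: n => n m /= [Nn Nm] nm; exists n, m.
  apply: bigcup_open => -[n m] _ /=.
  have cA k : continuous (A k).
    by move=> x; apply: cvgMr; exact: birkhoff_sum_fiber_continuous.
  rewrite -[X in open X]/((fun x => `|A m x - A n x|) @^-1` [set y | e0 / 4 < y]).
  apply: open_comp; last exact: open_gt.
  by move=> x _; apply: cvg_norm; apply: cvgB; exact: cA.
have dV N x r : 0 < r -> exists2 y, mdist x y < r & V N y.
  move=> r0; have kap0 : 0 < e0 / 16 by rewrite divr_gt0.
  have [eps eps0 [C C0 CP]] := birkhoff_sum_target p kap0.
  have er0 : 0 < Num.min eps (r / 2) by rewrite lt_min eps0 divr_gt0.
  have [M M0 MP] := specification sp er0.
  have [z zP] := CP w M.
  have [B B0 BP] := birkhoff_sum_bound alpha T h cphi.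
  (* Beyond [N1] the delay [M] and the constant [C] together cost at most [e0 / 16] in the
     averages. *)
  have [N1 [N10 N1P]] := natr_dominates (2 * B * M%:R + C) kap0.
  have [m Nm nm] := osc (N + N1)%N (N + N1)%N; set n := (N + N1)%N in Nm nm.
  (* The first segment has length 0 and only places the initial point near [x]; the second contains
     both windows [n] and [m]. *)
  pose Z j := if j is 0%N then x else z.
  pose len j := if j is 0%N then 0%N else (n + m)%N.
  have [y yP] := MP Z len.
  have close k : (N1 <= k)%N -> (k <= n + m)%N ->
      `|A (M + k)%N y - k%:R^-1 * Phi k p| <= e0 / 8.
    move=> N1k knm; have k0 : (0 < k)%N by exact: leq_trans N1k.
    have k0' : 0 < k%:R :> R by rewrite ltr0n.
    rewrite (le_trans (ler_distD (k%:R^-1 * Phi k (iter M Theta (w, y))) _ _))//.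
    have := average_shift (w, y) M BP k0.
    have : `|Phi k (iter M Theta (w, y)) - Phi k p| <= e0 / 16 * k%:R + C.
      apply: zP => i ik; have := yP 1%N i => /=.
      rewrite add0n => /(_ (leq_trans (ltnW ik) knm))/le_trans; apply.
      by rewrite ge_min lexx.
    move=> H1 H2; rewrite -mulrBr normrM [X in _ + X * _]ger0_norm ?invr_ge0//.
    rewrite (le_trans (lerD H2 (ler_wpM2l _ H1))) ?invr_ge0// mulrC -mulrDr.
    rewrite mulrC ler_pdivrMr//; have := N1P k N1k; lra.
  exists y.
    rewrite torus_distE -torus_normN opprB; have := yP 0%N 0%N isT => /=.
    move=> /le_lt_trans; apply; rewrite gt_min; apply/orP; right.
    by rewrite ltr_pdivrMr// ltr_pMr// ltr1n.
  exists (M + n)%N, (M + m)%N; split.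
  - by rewrite (leq_trans (leq_addr N1 N))// leq_addl.
  - by rewrite (leq_trans _ (leq_addl _ _))// (leq_trans _ Nm)// leq_addr.
  have Hn := close n (leq_addl _ _) (leq_addr _ _).
  have Hm := close m (leq_trans (leq_addl _ _) Nm) (leq_addl _ _).
  set a := A (M + n)%N y in Hn *; set b := A (M + m)%N y in Hm *.
  set u := n%:R^-1 * _ in Hn; set v := m%:R^-1 * _ in Hm.
  have {}nm : e0 <= `|v - u| by [].
  have : `|v - u| <= `|b - v| + `|b - a| + `|a - u|.
    have -> : v - u = (v - b) + (b - a) + (a - u) by lra.
    rewrite (le_trans (ler_normD _ _))// lerD//.
    by rewrite (le_trans (ler_normD _ _))// distrC.
  by lra.
(* [first_category] asks for an equality, so the complements of the [V N] are cut down to the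
   complement of [Irr]. *)
exists (fun N => ~` V N `&` ~` Irr); last first.
  apply/seteqP; split => [x nIrrx|x [N _ []//]].
  have : ~ (\bigcap_N V N) x by move=> /VIrr.
  by move=> /existsNP[N /not_implyP[_ nV]]; exists N.
move=> N; rewrite /nowhere_dense -subset0 => x /= /nbhs_ballP[r r0 rP].
have [y xy Vy] := dV N x r r0.
have : closure (~` V N) y.
  apply: (closureS (_ : ~` V N `&` ~` Irr `<=` ~` V N)); first by move=> ? [].
  by apply: rP; rewrite ballEmdist.
by rewrite -(closure_id _).1//; exact: open_closedC.
Qed.

End irregular.

(** * Entropy as a growth rate *)

Section separated_families.
Context {R : realType} {X : metricType R}.
Implicit Types (f : nat -> X -> X).

Lemma bowen_distP f n (e : R) x y : 0 <= e ->
  reflect (exists2 i, (i < n)%N & e < mdist (f i x) (f i y))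
    (e < bowen_dist f n x y).
Proof.
move=> e0; apply: (iffP idP) => [|[i ni exy]].
  rewrite /bowen_dist => H; apply: contrapT => ne; move: H.
  rewrite ltNge => /negP; apply; apply: bigmax_le => // i _.
  by rewrite leNgt; apply/negP => exy; apply: ne; exists i.
apply: (lt_le_trans exy).
exact: (le_bigmax _ (fun i : 'I_n => mdist (f i x) (f i y)) (Ordinal ni)).
Qed.

(** Indexed families stand for separated sets, which makes subfamilies, images and one-point
    extensions easy to form; for [0 <= e] they are injective. *)
Definition separating f n (e : R) k :=
  exists q : 'I_k -> X, forall i j, i != j -> e < bowen_dist f n (q i) (q j).

Lemma separatingS f n e e' k : e' <= e -> separating f n e k -> separating f n e' k.
Proof. by move=> ee' [q qP]; exists q => i j /qP; exact: le_lt_trans. Qed.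

Lemma separating_ge f n e k : 0 <= e -> separating f n e k ->
  (k%:R%:E <= max_separated f n e)%E.
Proof.
move=> e0 [q qP]; apply: ereal_sup_ubound; exists k => //; exists (range q).
  have qI : injective q.
    move=> i j qij; apply/eqP/negPn/negP => /qP; rewrite qij.
    by move=> /(bowen_distP _ _ _ _ e0)[m _]; rewrite mdistxx ltNge e0.
  have <- : [set nat_of_ord i | i in [set: 'I_k]] = `I_k.
    apply/seteqP; split => [_ [i _ <-] /=|i /= ik].
      exact: ltn_ord.
    by exists (Ordinal ik).
  have e1 : (range q #= [set: 'I_k])%card by apply: inj_card_eq => i j _ _; exact: qI.
  have e2 : ([set nat_of_ord i | i in [set: 'I_k]] #= [set: 'I_k])%card.
    by apply: inj_card_eq => i j _ _; exact: val_inj.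
  by rewrite (card_eql e1) card_eq_sym.
move=> _ _ [i _ <-] [j _ <-] qij; apply: qP.
by apply/eqP => ij; apply: qij; rewrite ij.
Qed.

Lemma lt_separating f n (e r : R) : (r%:E < max_separated f n e)%E ->
  exists2 k, r < k%:R & separating f n e k.
Proof.
move=> /ereal_sup_gt[_ [k [Q Qk Qsep] <-]]; rewrite lte_fin => rk; exists k => //.
have sk := card_fset_set Qk.
have fQ : finite_set Q by apply/finite_setP; exists k.
pose s := finmap.enum_fset (fset_set Q).
have us : uniq s by exact: finmap.fset_uniq.
have sQ x : x \in s -> Q x.
  by move=> xs; apply/set_mem; rewrite -(in_fset_set fQ).
exists (fun i => tnth (in_tuple s) (cast_ord (esym sk) i)) => i j ij.
apply: Qsep; [exact/sQ/mem_tnth|exact/sQ/mem_tnth|].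
apply/eqP; apply: contra ij => /eqP.
have /tuple_uniqP inj : uniq (in_tuple s) by [].
by move=> /inj/(congr1 val)/= ij; apply/eqP/val_inj.
Qed.

End separated_families.

Section growth.
Context {R : realType}.
Local Open Scope ereal_scope.

(** Entropies may be infinite; this reduces their comparison to real rates. *)
Lemma lee_by_lt (x y : \bar R) : (forall r : R, r%:E < x -> r%:E <= y) -> x <= y.
Proof.
move=> H; rewrite leNgt; apply/negP => yx.
case: y => [y| |] in H yx.
- have : y%:E < x by [].
  case: x => [x| |] in H yx * => //.
    move=> _; rewrite lte_fin in yx.
    have := H ((x + y) / 2)%R; rewrite lte_fin lee_fin => H'.
    by have : ((x + y) / 2 <= y)%R; [apply: H'|]; lra.
  by move=> _; have := H (y + 1)%R (ltry _); rewrite lee_fin leNgt ltrDl ltr01.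
- by rewrite ltNge leey in yx.
- case: x => [x| |] in H yx => //.
    by have := H (x - 1)%R; rewrite lte_fin ltrBlDr ltrDl ltr01 leeNy_eq => /(_ isT).
  by have := H 0%R (ltry _); rewrite leeNy_eq.
Qed.

Lemma limn_esup_ge (u : nat -> \bar R) (g : \bar R) :
  (forall N, exists2 n, (N <= n)%N & g <= u n) -> g <= limn_esup u.
Proof.
move=> H; apply: le_ereal_inf_tmp => _ [V [N _ NV] <-].
have [n Nn gu] := H N; apply: (le_trans gu); apply: ereal_sup_ubound.
by exists n => //; exact: NV.
Qed.

Lemma lt_limn_esup (u : nat -> \bar R) (g : \bar R) :
  g < limn_esup u -> forall N, exists2 n, (N <= n)%N & g < u n.
Proof.
move=> gu N; have : g < ereal_sup [set u n | n in [set n | (N <= n)%N]].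
  apply: (lt_le_trans gu); apply: ereal_inf_lbound.
  by exists [set n | (N <= n)%N] => //; exists N.
by move=> /ereal_sup_gt[_ [n Nn <-]]; exists n.
Qed.

Lemma at_right_limE (H : R -> \bar R) :
  (forall e e' : R, (0 < e)%R -> (e <= e')%R -> H e' <= H e) ->
  lim (H e @[e --> 0^'+]) = ereal_sup [set H e | e in [set e | (0 < e)%R]].
Proof.
move=> Hdec; have := @nonincreasing_at_right_cvge _ H 0%R +oo%O isT.
move=> /(_ _)/cvg_lim -> //.
  congr (ereal_sup (_ @` _)); apply/seteqP; split=> x /=; rewrite in_itv/= ?andbT//.
by move=> e e'; rewrite !in_itv/= !andbT => e0 _ ee'; exact: Hdec.
Qed.

Context {X : metricType R}.
Implicit Types (f : nat -> X -> X).

(** A real-valued substitute for [g%:E <= separation_rate f e]: for [0 <= e] it implies this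
    inequality and follows from the strict one. *)
Definition growth f (e g : R) := forall N, exists2 n, (N <= n)%N &
  exists2 k, (expR (g * n%:R) <= k%:R)%R & separating f n e k.

Definition separation_rate f (e : R) : \bar R :=
  limn_esup (fun n => (n%:R^-1)%:E * lne (max_separated f n e)).

Lemma growth_le f (e g : R) : (0 <= e)%R -> growth f e g ->
  g%:E <= separation_rate f e.
Proof.
move=> e0 gr; apply: limn_esup_ge => N.
have [n Nn [k gk sep]] := gr N.+1; exists n; first exact: ltnW.
have n0 : (0 < n%:R :> R)%R by rewrite ltr0n; exact: leq_trans Nn.
rewrite muleC lee_pdivlMr// -EFinM.
have k0 : (0 < k%:R :> R)%R by exact: lt_le_trans (expR_gt0 _) gk.
have := separating_ge e0 sep; rewrite -lee_lne; last 2 first.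
- by rewrite in_itv/= lee_fin ler0n leey.
- rewrite in_itv/= leey andbT; apply: le_trans (separating_ge e0 sep).
  by rewrite lee_fin.
apply: le_trans; rewrite lne_EFin// lee_fin.
by rewrite -[leLHS]expRK ler_ln ?posrE// expR_gt0.
Qed.

Lemma lt_growth f (e g : R) : (0 <= e)%R -> g%:E < separation_rate f e ->
  growth f e g.
Proof.
move=> e0 /lt_limn_esup gr N; have [n Nn gn] := gr N.+1.
exists n; first exact: ltnW.
have n0 : (0 < n%:R :> R)%R by rewrite ltr0n; exact: leq_trans Nn.
suff /lt_separating[k gk sep] : (expR (g * n%:R))%:E < max_separated f n e.
  by exists k => //; exact: ltW.
rewrite ltNge; apply/negP => msle.
have ms0 : 0 <= max_separated f n e.
  apply: (@separating_ge _ _ f n e 0%N e0).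
  exists (fun i => ffun0 (card_ord 0) i) => -[//].
have : lne (max_separated f n e) <= (g * n%:R)%:E.
  have <- : lne (expR (g * n%:R))%:E = (g * n%:R)%:E.
    by rewrite lne_EFin ?expR_gt0// expRK.
  by rewrite lee_lne// in_itv/= leey andbT// lee_fin expR_ge0.
move=> H; move: gn; rewrite ltNge => /negP; apply.
by rewrite muleC lee_pdivrMr.
Qed.

Lemma separation_rate_nonincreasing f (e e' : R) : (0 < e)%R -> (e <= e')%R ->
  separation_rate f e' <= separation_rate f e.
Proof.
move=> e0 ee'; apply: lee_by_lt => r rH; apply: growth_le; first exact: ltW.
move=> N; have [|n Nn [k rk sep]] := lt_growth _ rH N.
  by rewrite (le_trans _ ee')// ltW.
by exists n => //; exists k => //; exact: separatingS sep.
Qed.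

Lemma growth_le_lim f (e g : R) : (0 < e)%R -> growth f e g ->
  g%:E <= lim (separation_rate f e @[e --> 0^'+]).
Proof.
move=> e0 gr; rewrite at_right_limE; last exact: separation_rate_nonincreasing.
apply: le_trans (growth_le (ltW e0) gr) _.
by apply: ereal_sup_ubound; exists e.
Qed.

Lemma lt_lim_growth f (g : R) :
  g%:E < lim (separation_rate f e @[e --> 0^'+]) ->
  exists2 e, (0 < e)%R & growth f e g.
Proof.
rewrite at_right_limE; last exact: separation_rate_nonincreasing.
move=> /ereal_sup_gt[_ [e /= e0 <-] gr]; exists e => //.
exact: (lt_growth (ltW e0)).
Qed.

End growth.

(** * Comparison of entropies *)

Lemma exists_large_class k J (c : 'I_k -> 'I_J.+1) :
  exists b, (k <= J.+1 * #|[pred i | c i == b]|)%N.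
Proof.
pose b := [arg max_(b > ord0) #|[pred i | c i == b]|]%N.
exists b; rewrite -[leqLHS]card_ord -sum1_card (partition_big c predT)//=.
rewrite -[X in (_ <= X * _)%N]card_ord -sum_nat_const; apply: leq_sum => j _.
rewrite sum1_card /b; case: arg_maxnP => //= i _ H; apply: leq_trans (H j isT).
by rewrite eq_leq//; apply: eq_card => x; rewrite !inE.
Qed.

Section equal_entropies.
Context {R : realType} (alpha : R) (T : torus R -> torus R) (sp : splitting T).
Context (h : circle R -> torus R).
Context (alphaI : irrational alpha) (ch : continuous h).
Local Notation rot := (rotation alpha).
Local Notation F := (fiber_map T h).
Local Notation Theta := (skew_product alpha T h).
Local Notation iterT := (fun i => iter i T).
Local Notation iterTheta := (fun i => iter i Theta).

Lemma mdist_iter i x y :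
  mdist (iter i T x) (iter i T y) = torus_norm (iter i T (x - y)).
Proof. by rewrite torus_distE (iter_splittingB sp). Qed.

(** Translations cancel in differences, so the fiber maps have the Bowen distances of [T], and a
    constant is integrated against a probability. *)
Lemma fiber_entropyE :
  fiber_entropy (@circle_lebesgue R) rot F = topological_entropy T.
Proof.
have dE w : bowen_dist (fiber_iter rot F w) = bowen_dist iterT.
  apply/funext => n; apply/funext => x; apply/funext => y.
  apply: eq_bigr => i _; rewrite mdist_iter torus_distE.
  by rewrite (fiber_iterB alpha sp h).
have sE w n e : max_separated (fiber_iter rot F w) n e = max_separated iterT n e.
  by rewrite /max_separated /Defs.separated dE.
suff rateE : (fun e : R => limn_esup (fun n => (n%:R^-1)%:E *
    \int[@circle_lebesgue R]_w lne (max_separated (fiber_iter rot F w) n e))%E)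
  = separation_rate iterT by rewrite /fiber_entropy rateE.
apply/funext => e; congr limn_esup; apply/funext => n; congr (_ * _)%E.
under eq_integral do rewrite sE.
rewrite integral_cst// -[RHS]mule1; congr (_ * _)%E.
exact: (@probability_setT _ _ _ (@circle_lebesgue R)).
Qed.

Lemma separating_skew_product n e k : 0 <= e ->
  separating iterT n e k -> separating iterTheta n e k.
Proof.
move=> e0 [q qP]; exists (fun i => (0 : circle R, q i)) => i j ij.
have /(bowen_distP _ _ _ _ e0)[m mn md] := qP i j ij.
apply/bowen_distP => //; exists m => //.
by rewrite (skew_product_dist _ sp) -mdist_iter.
Qed.

(** Sort the points by which of the first [J + 1] points of the orbit of 0 lies near their base
    point, and move a largest class into the fiber over that point, each orbit by at most [e / 4].
    Base points of one class stay within [e], so separation happens in the fibers, and [e / 2] of it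
    is left. *)
Lemma separating_skew_product_base e : 0 < e -> exists J, forall n k,
  separating iterTheta n e k ->
  exists2 k', (k <= J.+1 * k')%N & separating iterT n (e / 2) k'.
Proof.
move=> e0; have e40 : 0 < e / 4 by rewrite divr_gt0.
have [d d0 dP] := fiber_stability alpha sp ch e40.
have m0 : 0 < Num.min d (e / 2) by rewrite lt_min d0 divr_gt0.
have [J JP] := rotation_uniformly_dense alphaI m0.
exists J => n k [q qP].
have /choice[c cP] i : exists j : 'I_J.+1,
    circle_norm ((q i).1 - iter j rot 0) < Num.min d (e / 2).
  have [j jJ jd] := JP 0 (q i).1; exists (Ordinal (jJ : (j < J.+1)%N)) => /=.
  by rewrite -opprB circle_normN.
have /choice[v vP] i : exists v, forall n x,
    mdist (fiber_iter rot F (q i).1 n x)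
      (fiber_iter rot F (iter (c i) rot 0) n (x - v)) <= e / 4.
  by apply: dP; have := cP i; rewrite lt_min => /andP[].
have [b kb] := exists_large_class c.
exists #|[pred i | c i == b]| => //.
exists (fun j => (q (enum_val j)).2 - v (enum_val j)) => j j' jj'.
have e20 : 0 <= e / 2 by rewrite divr_ge0// ltW.
set i := enum_val j; set i' := enum_val j'.
have ci : c i = b by have := enum_valP j; rewrite inE => /eqP.
have ci' : c i' = b by have := enum_valP j'; rewrite inE => /eqP.
have ii' : i != i' by apply: contra jj' => /eqP/enum_val_inj ->.
have /(bowen_distP _ _ _ _ (ltW e0))[m mn] := qP _ _ ii'.
rewrite !iter_skew_product -[ltRHS]/(Num.max (mdist _ _) (mdist _ _)) /= lt_max.
move=> /orP[|em].
  rewrite ltNge circle_distE !iter_rotation opprD addrACA subrr addr0.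
  have := cP i; have := cP i'; rewrite ci ci' !lt_min => /andP[_ bi'] /andP[_ bi].
  have := circle_normD ((q i).1 - iter b rot 0) (iter b rot 0 - (q i').1).
  rewrite subrKA -(opprB (q i').1 (iter b rot 0)) circle_normN => bii'.
  by rewrite (le_trans bii')//; lra.
apply/bowen_distP => //; exists m => //.
rewrite mdist_iter -(fiber_iterB alpha sp h (iter b rot 0)) -torus_distE.
have := vP i' m (q i').2; have := vP i m (q i).2; rewrite ci ci'.
set y := fiber_iter rot F (iter b rot 0) m ((q i).2 - v i).
set y' := fiber_iter rot F (iter b rot 0) m ((q i').2 - v i') => yP y'P.
rewrite metric_sym in y'P; set A := fiber_iter rot F _ m _ in em yP.
set B := fiber_iter rot F _ m _ in em y'P.
have := metric_triangle A y B; have := metric_triangle y y' B.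
lra.
Qed.

Lemma topological_entropy_skew_product :
  topological_entropy T = topological_entropy Theta.
Proof.
apply/eqP; rewrite eq_le; apply/andP; split; apply: lee_by_lt => g.
  move=> /lt_lim_growth[e e0 gr]; apply: (growth_le_lim e0) => N.
  have [n Nn [k gk sep]] := gr N; exists n => //; exists k => //.
  exact: separating_skew_product (ltW e0) sep.
move=> gT; apply: lee_by_lt => g'; rewrite lte_fin => g'g.
move: gT => /lt_lim_growth[e e0 gr].
have [J JP] := separating_skew_product_base e0.
have e20 : 0 < e / 2 by rewrite divr_gt0.
apply: (growth_le_lim e20) => N.
have gg' : 0 < g - g' by rewrite subr_gt0.
(* The factor [J + 1] lost in the count is absorbed by [g - g'] for large [n]. *)
have [N1 [N10 N1P]] := natr_dominates (ln J.+1%:R) gg'.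
have [n Nn [k gk sep]] := gr (N + N1)%N.
have [k' kk' sep'] := JP n k sep.
exists n; first by rewrite (leq_trans _ Nn)// leq_addr.
exists k' => //; have J0 : 0 < J.+1%:R :> R by rewrite ltr0n.
rewrite -(ler_pM2l J0) -natrM; apply: le_trans (_ : k%:R <= _);
  last by rewrite ler_nat.
apply: le_trans gk; rewrite -[X in X * _](lnK (_ : _ \is Num.pos)) ?posrE//.
rewrite -expRD ler_expR.
have := N1P n (leq_trans (leq_addl _ _) Nn); lra.
Qed.

End equal_entropies.

(** * Upper bound for the Bowen entropy of a subset *)

Section bowen_entropy.
Context {R : realType} {X : metricType R} (T : X -> X).
Local Notation iterT := (fun i => iter i T).
Local Open Scope ereal_scope.

Lemma bowen_sum_le Z (s : R) N (e e' : R) : (e <= e')%R ->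
  bowen_sum T Z s N e' <= bowen_sum T Z s N e.
Proof.
move=> ee'; apply: le_ereal_inf => _ [I [n [x [nN ZI ->]]]].
exists I, n, x; split => // z /ZI[i Ii zi]; exists i => //.
exact: lt_le_trans zi ee'.
Qed.

Lemma bowen_sum_ge0 Z (s : R) N (e : R) : 0 <= bowen_sum T Z s N e.
Proof.
apply: le_ereal_inf_tmp => _ [I [n [x [_ _ ->]]]].
by apply: esum_ge0 => i _; rewrite lee_fin expR_ge0.
Qed.

Lemma bowen_sum_nondecreasing Z (s : R) (e : R) :
  nondecreasing_seq (fun N => bowen_sum T Z s N e).
Proof.
move=> N N' NN'; apply: le_ereal_inf => _ [I [n [x [nN ZI ->]]]].
by exists I, n, x; split => // i /nN; exact: leq_trans.
Qed.

Lemma bowen_measure_eq0 Z (s e : R) :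
  bowen_measure T Z s e = 0 <-> forall N, bowen_sum T Z s N e = 0.
Proof.
have cv := ereal_nondecreasing_cvgn (bowen_sum_nondecreasing Z s e).
split => [m0 N|s0].
  apply/eqP; rewrite eq_le bowen_sum_ge0 andbT -m0 /bowen_measure (cvg_lim _ cv)//.
  by apply: ereal_sup_ubound; exists N.
rewrite /bowen_measure (_ : (fun N => _) = cst 0); last exact/funext.
exact: lim_cst.
Qed.

Lemma bowen_entropy_at_nonincreasing Z (e e' : R) : (0 < e)%R -> (e <= e')%R ->
  bowen_entropy_at T Z e' <= bowen_entropy_at T Z e.
Proof.
move=> e0 ee'; apply: le_ereal_inf => _ [s /bowen_measure_eq0 s0 <-].
exists s => //; apply/bowen_measure_eq0 => N; apply/eqP.
by rewrite eq_le bowen_sum_ge0 andbT -(s0 N) bowen_sum_le.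
Qed.

(** A maximal separated family spans: a point farther than [e / 2] from all its members could be
    added. So [k] balls of the same order [n] form a cover. *)
Lemma bowen_sum_separating_le Z (s e : R) N n k (y0 : X) :
  (0 < e)%R -> (N <= n)%N ->
  separating iterT n (e / 2) k -> ~ separating iterT n (e / 2) k.+1 ->
  bowen_sum T Z s N e <= (k%:R * expR (- (s * n%:R)))%:E.
Proof.
move=> e0 Nn [q qP] kmax; have e20 : (0 <= e / 2)%R by rewrite divr_ge0// ltW.
have cover y : exists i, (bowen_dist iterT n (q i) y <= e / 2)%R.
  apply: contrapT => nc; apply: kmax.
  have yP i : (e / 2 < bowen_dist iterT n (q i) y)%R.
    by rewrite ltNge; apply/negP => iy; apply: nc; exists i.
  have sym x z : bowen_dist iterT n x z = bowen_dist iterT n z x.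
    by apply: eq_bigr => i _; rewrite metric_sym.
  exists (fun i => if unlift ord_max i is Some j then q j else y) => i j.
  case: unliftP => [i'|] ->; case: unliftP => [j'|] ->; rewrite ?eqxx// => ij.
    by apply: qP; apply: contra ij => /eqP ->.
  by rewrite sym.
(* [y0] shows that the family is nonempty, which provides a center for indices outside [I_k]. *)
have k0 : (0 < k)%N by have [[i ik] _] := cover y0; exact: leq_ltn_trans ik.
pose x i := q (insubd (Ordinal k0) i).
apply: ereal_inf_lbound; exists `I_k, (fun=> n), x; split => //.
  move=> y _; have [i iy] := cover y; exists i; first exact: ltn_ord.
  rewrite /bowen_ball /x /= valKd (le_lt_trans iy)//.
  by rewrite ltr_pdivrMr// ltr_pMr// ltr1n.
rewrite esum_fset//.
by rewrite -fsbig_ord/= sumEFin sumr_const card_ord mulr_natl.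
Qed.

(** If separated sets eventually have fewer than [exp (r n)] points, then for the exponent [r + d]
    the covers by balls of one order [n] have sums at most [exp (- d n)], which tend to 0. *)
Lemma bowen_entropy_le Z (y0 : X) : bowen_entropy T Z <= topological_entropy T.
Proof.
rewrite /bowen_entropy at_right_limE; last exact: bowen_entropy_at_nonincreasing.
apply: ge_ereal_sup => _ [e /= e0 <-].
have e20 : (0 < e / 2)%R by rewrite divr_gt0.
apply: lee_by_lt => r rB; apply: (growth_le_lim e20); apply: contrapT.
move=> /existsNP[N0 nN0]; move: rB; rewrite ltNge => /negP; apply.
have bound n k : (N0 <= n)%N -> separating iterT n (e / 2) k ->
    (k%:R < expR (r * n%:R))%R.
  move=> N0n sep; rewrite ltNge; apply/negP => kr; apply: nN0.
  by exists n => //; exists k.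
apply/lee_addgt0Pr => d d0; rewrite -EFinD; apply: ereal_inf_lbound.
exists (r + d)%R => //; apply/bowen_measure_eq0 => N.
apply/eqP; rewrite eq_le bowen_sum_ge0 andbT.
apply/lee_addgt0Pr => eps eps0; rewrite add0e.
have [N1 [_ N1P]] := natr_dominates (- ln eps) d0.
pose n := (N0 + N + N1)%N.
have N0n : (N0 <= n)%N by rewrite /n -addnA leq_addr.
have [k sep nsep] : exists2 k,
    separating iterT n (e / 2) k & ~ separating iterT n (e / 2) k.+1.
  apply: contrapT => nk.
  have all k : separating iterT n (e / 2) k.
    elim: k => [|k IH]; last by apply: contrapT => nk1; apply: nk; exists k.
    by exists (fun i => ffun0 (card_ord 0) i) => -[].
  have := bound n (Num.truncn (expR (r * n%:R))).+1 N0n (all _).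
  have /andP[_] := truncn_itv (expR_ge0 (r * n%:R)%R).
  by move=> /lt_trans/[apply]; rewrite ltxx.
have Nn : (N <= n)%N by rewrite /n addnAC leq_addl.
apply: (le_trans (bowen_sum_separating_le Z (r + d) y0 e0 Nn sep nsep)).
rewrite lee_fin -[leRHS]lnK ?posrE// -[leRHS]mul1r.
have kr := ltW (bound n k N0n sep).
apply: (@le_trans _ _ (expR (r * n%:R) * expR (- ((r + d) * n%:R)))%R).
  by rewrite ler_wpM2r ?expR_ge0.
rewrite -expRD mul1r ler_expR; have := N1P n (leq_addl _ _); lra.
Qed.

End bowen_entropy.

(** * Lower bound for the entropy of irregular fibers *)

Section cylinder_cover.
Context {R : realType} (m : nat).
Context (m0 : (0 < m)%N).

Let mR0 : 0 < m%:R :> R. Proof. by rewrite ltr0n. Qed.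

Let truncn_digit (x : R) : 0 <= x ->
  Num.truncn (m%:R * x) = (m * Num.truncn x + Num.truncn (m%:R * x) %% m)%N.
Proof.
move=> x0; rewrite [LHS](divn_eq _ m) mulnC; congr (m * _ + _)%N.
have mx0 : 0 <= m%:R * x by rewrite mulr_ge0.
have /andP[tx xt] := truncn_itv mx0; apply/esym/truncn_def.
set t := Num.truncn (m%:R * x) in tx xt *.
rewrite -(ler_pM2l mR0) -(ltr_pM2l mR0) -!natrM; apply/andP; split.
  by rewrite (le_trans _ tx)// ler_nat mulnC leq_divM.
by rewrite (lt_le_trans xt)// ler_nat mulnC ltn_ceil.
Qed.

(* The base-[m] digits of a real number in [0, 1[ turn a cover of the sequence
   space by cylinders into a cover of [0, 1[ by [m]-adic intervals. *)
Lemma cylinder_cover (I : set nat) (D : nat -> nat)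
    (B : nat -> set (nat -> 'I_m)) (K : R) (f : nat -> R) :
  0 <= K -> (forall i, I i -> 0 <= f i) ->
  (forall i, I i -> m%:R ^- D i <= K * f i) ->
  (forall i a a' c, I i -> B i a -> B i a' -> (c < D i)%N -> a c = a' c) ->
  (forall a, exists2 i, I i & B i a) ->
  (1 <= K%:E * \esum_(i in I) (f i)%:E)%E.
Proof.
move=> K0 f0 fK Beq cover.
pose dig (r : R) (c : nat) : 'I_m :=
  Ordinal (ltn_pmod (Num.truncn (m%:R ^+ c.+1 * r)) m0).
have dig_eq d (r r' : R) : 0 <= r < 1 -> 0 <= r' < 1 ->
    (forall c, (c < d)%N -> dig r c = dig r' c) ->
    Num.truncn (m%:R ^+ d * r) = Num.truncn (m%:R ^+ d * r').
  move=> r01 r'01; elim: d => [_|d IH H].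
    by rewrite !mul1r (@truncn_def _ r 0) ?(@truncn_def _ r' 0).
  have /andP[r0 _] := r01; have /andP[r'0 _] := r'01.
  have IH' := IH (fun c cd => H c (leqW cd)).
  have /(congr1 val)/= := H d (leqnn _); rewrite !exprS -!mulrA.
  have mr0 : 0 <= m%:R ^+ d * r by rewrite mulr_ge0// exprn_ge0.
  have mr'0 : 0 <= m%:R ^+ d * r' by rewrite mulr_ge0// exprn_ge0.
  by move=> mod_eq; rewrite (truncn_digit mr0) (truncn_digit mr'0) IH' mod_eq.
(* Codes in [B i] share their first [D i] digits, so the numbers they encode lie in one m-adic
   interval of order [D i], with index [k i]; the index is 0 if there are none. *)
have /choice[k kP] i : exists k : nat, I i -> forall r, 0 <= r < 1 -> B i (dig r) ->
    Num.truncn (m%:R ^+ D i * r) = k.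
  have [[r0 [r01 Br0]]|nr] := pselect (exists r0, 0 <= r0 < 1 /\ B i (dig r0)).
    exists (Num.truncn (m%:R ^+ D i * r0)) => Ii r r1 Br; apply: dig_eq => // c cD.
    exact: (Beq i).
  by exists 0%N => _ r r01 Br; exfalso; apply: nr; exists r.
pose J i : set R := if i \in I
  then `[(k i)%:R / m%:R ^+ D i, (k i).+1%:R / m%:R ^+ D i[%classic
  else set0.
have mJ i : measurable (J i).
  by rewrite /J; case: ifPn => _; [exact: measurable_itv|exact: measurable0].
have cJ : `[0, 1[%classic `<=` \bigcup_i J i.
  move=> r /=; rewrite in_itv/= => r01; have [i Ii Bi] := cover (dig r).
  exists i => //; rewrite /J mem_set//= in_itv/=.
  have mD0 : 0 < m%:R ^+ D i :> R by rewrite exprn_gt0.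
  rewrite ler_pdivrMr// ltr_pdivlMr// ![r * _]mulrC -(kP i Ii r r01 Bi).
  have /andP[r0 _] := r01.
  by apply: truncn_itv; apply: mulr_ge0 => //; exact: ltW.
have : (lebesgue_measure (`[0%R, 1%R[%classic : set R) <=
    \big[+%E/0]_(0 <= i <oo) lebesgue_measure (J i))%E.
  exact: (measure_sigma_subadditive (@lebesgue_measure R) mJ
    (measurable_itv `[0, 1[) cJ).
rewrite lebesgue_measure_itv/= lte_fin ltr01 oppr0 adde0 => /le_trans; apply.
have -> : I = [set i | i \in I] by apply/seteqP; split=> i /=; rewrite ?inE.
rewrite -nneseries_esum; last first.
  by move=> i; rewrite inE => Ii; rewrite lee_fin f0.
rewrite -nneseriesZl; last by move=> i; rewrite inE => Ii; rewrite lee_fin f0.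
rewrite [leRHS]eseries_mkcond; apply: lee_nneseries => // i _.
rewrite /J; case: ifPn => [|_]; last by rewrite measure0.
rewrite inE => Ii; rewrite lebesgue_measure_itv/= -EFinM.
case: ifPn => _; last by rewrite lee_fin mulr_ge0// f0.
rewrite -EFinB lee_fin (le_trans _ (fK i Ii))//.
by rewrite -mulrBl -natr1 addrAC subrr add0r mul1r.
Qed.

End cylinder_cover.

(** * Irregular points coded by free choices *)

Section moran.
Context {R : realType} (alpha : R) (T : torus R -> torus R) (sp : splitting T).
Context (h : circle R -> torus R) (phi : circle R * torus R -> R).
Context (alphaI : irrational alpha) (ch : continuous h) (cphi : continuous phi).
Local Notation rot := (rotation alpha).
Local Notation F := (fiber_map T h).
Local Notation Theta := (skew_product alpha T h).
Local Notation Phi := (birkhoff_sum alpha T h phi).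

Section schedule.
Context (n0 M : nat) (M0 : (0 < M)%N) (K : nat) (pick : nat -> nat -> nat)
  (pickP : forall l L, (L <= pick l L)%N).

(* [left] counts the free segments still to come before the next shadowing
   segment, whose length is [len]; [used] counts the free segments so far. Free
   segments have length [n0], and a gap of length [M] follows each segment. *)
Record state := State { left : nat; len : nat; time : nat; used : nat }.

(** The [l + M] free segments pay one unit of time each for the shadowing segment of length [l] and
    its gap; hence the value [n0 + M + 1] of [rate]. *)
Definition block l s c := State (l + M) l s c.

(** The new shadowing length is asked to be at least the elapsed time [s], so that the window is not
    negligible against its past. *)
Definition next (st : state) : state :=
  if left st is i.+1 then State i (len st) (time st + n0 + M) (used st).+1
  else let s := (time st + len st + M)%N in
       block (pick (len st) (K + s + M)) s (used st).

Fixpoint schedule j : state :=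
  if j is j'.+1 then next (schedule j') else block (pick 0 (K + M)) 0 0.

Definition segment j : nat :=
  if left (schedule j) is _.+1 then n0 else len (schedule j).

Lemma start_schedule j : start segment M j = time (schedule j).
Proof.
elim: j => //= j ->; rewrite /next /segment.
by case: (left (schedule j)).
Qed.

Lemma time_schedule_ge j : (j <= time (schedule j))%N.
Proof.
by elim: j => //= j IH; rewrite /next; case: (left _) => [|i] /=; lia.
Qed.

Definition rate := (n0 + M).+1.

(** The second inequality is the bound at the end of the current block, and carries the induction
    through it. *)
Lemma time_schedule_le j : (time (schedule j) <= rate * used (schedule j))%N /\
  (time (schedule j) + left (schedule j) * (n0 + M) + len (schedule j) + M
    <= rate * (used (schedule j) + left (schedule j)))%N.
Proof.
elim: j => [|j] /=; first by rewrite /rate; split; nia.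
by rewrite /next; case: (schedule j) => -[|i] l s c [] /=; rewrite /rate; nia.
Qed.

(** The last left-hand side is the time at which the shadowing segment of the block starts: the past
    before the block is at most its length [l], and the [l + M <= 2 l] free segments take [n0 + M]
    each. *)
Lemma time_schedule_len j :
  (K <= len (schedule j))%N /\ (M <= len (schedule j))%N /\
  (time (schedule j) + left (schedule j) * (n0 + M)
    <= len (schedule j) * (2 * rate))%N.
Proof.
elim: j => [|j] /=.
  by have := pickP 0 (K + M); set l := pick _ _ => lP; rewrite /rate; nia.
rewrite /next; case: (schedule j) => -[|i] l s c [] /=; last by rewrite /rate; nia.
move=> Kl [Ml sl]; have := pickP l (K + (s + l + M) + M).
by set l' := pick _ _; rewrite /rate => lP; nia.
Qed.

Lemma schedule_reaches_block_end j : exists j', [/\ (j <= j')%N,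
  left (schedule j') = 0%N & len (schedule j') = len (schedule j)].
Proof.
move: {2}(left (schedule j)) (erefl (left (schedule j))) => i.
elim: i j => [|i IH] j ji; first by exists j.
have : left (schedule j.+1) = i by rewrite /= /next ji.
move=> /IH[j' [jj' j'0 lj']]; exists j'; split => //; first exact: ltnW.
by rewrite lj' /= /next ji.
Qed.

Lemma schedule_next_block j : left (schedule j) = 0%N -> exists L,
  len (schedule j.+1) = pick (len (schedule j)) L.
Proof. by move=> j0; rewrite /= /next j0; eexists. Qed.

(** Take the last segment starting by time [n]; it adds at most one free segment, hence the
    successor. *)
Lemma schedule_density n : exists2 j, (time (schedule j) <= n)%N &
  (n <= rate * (used (schedule j)).+1)%N.
Proof.
pose P j := (time (schedule j) <= n)%N.
have P0 : exists j, P j by exists 0%N.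
have Pn j : P j -> (j <= n)%N by apply: leq_trans; exact: time_schedule_ge.
case: (ex_maxnP P0 Pn) => j Pj jmax; exists j => //.
have : ~~ P j.+1 by apply/negP => /jmax; rewrite ltnn.
rewrite -ltnNge => /ltnW/leq_trans; apply.
have [+ _] := time_schedule_le j.+1; move=> /leq_trans; apply.
by rewrite leq_mul2l /= /next; case: (left _) => [|i] //=; rewrite leqW.
Qed.

Lemma used_schedule j c : (c < used (schedule j))%N -> exists2 j',
  (j' < j)%N & [/\ segment j' = n0, used (schedule j') = c &
    (left (schedule j') != 0)%N].
Proof.
elim: j => // j IH /=; rewrite /next; case E: (left (schedule j)) => [|i] /=.
  by move=> /IH[j' j'j ?]; exists j' => //; exact: ltnW.
rewrite ltnS leq_eqVlt => /orP[/eqP ->|/IH[j' j'j ?]];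
  last by exists j' => //; exact: ltnW.
by exists j => //; rewrite /segment E.
Qed.

Lemma time_schedule_homo j j' : (j <= j')%N ->
  (time (schedule j) <= time (schedule j'))%N.
Proof.
move=> /subnK <-; elim: (j' - j)%N => // d IH; apply: (leq_trans IH).
by rewrite addSn /= /next; case: (left _) => [|i] /=; lia.
Qed.

End schedule.

(** The gap [M] is fixed before [n0], which can then be taken large against it. If the averages of
    [x a] converged, those over the shadowing windows, each a fixed proportion of the elapsed time,
    would have the same limit, whereas two successive ones follow averages of [p] that are [e0]
    apart. *)
Lemma irregular_shadowing_codes p w (eps : R) :
  irregular_set Theta phi p -> 0 < eps ->
  exists M, forall n0 m (q : 'I_m -> torus R),
  exists x : (nat -> 'I_m) -> torus R,
    (forall a, irregular_set Theta phi (w, x a)) /\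
    forall n, exists2 d, (n <= (n0 + M).+1 * d.+1)%N & forall c, (c < d)%N ->
      exists2 t, (t + n0 <= n)%N & forall a i, (i < n0)%N ->
        torus_norm (iter (t + i) T (x a) - iter i T (q (a c))) <= eps.
Proof.
move=> /not_cvg_oscillation[e0 e00 osc] eps0.
pose u n : R := n%:R^-1 * Phi n p.
have kap0 : 0 < e0 / 16 by rewrite divr_gt0.
have [eps1 eps10 [C C0 /(_ w)/choice[Z ZP]]] :=
  birkhoff_sum_target sp alphaI ch cphi p kap0.
have m0 : 0 < Num.min eps eps1 by rewrite lt_min eps0.
have [M M0 MP] := specification sp m0.
have [K [K0 KP]] := natr_dominates C kap0.
have /choice[pick' pickP'] (lL : nat * nat) :
    exists l', (lL.2 <= l')%N /\ e0 <= `|u l' - u lL.1|.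
  by have [l' ? ?] := osc lL.1 lL.2; exists l'.
pose pick l L := pick' (l, L).
have pickP l L : (L <= pick l L)%N by have [] := pickP' (l, L).
exists M => n0 m q; pose sch := schedule n0 M K pick.
pose seg := segment n0 M K pick.
(* Times and shadowing targets are independent of the code [a], so the c-th choice is read at the
   same time for all codes. *)
pose z (a : nat -> 'I_m) j :=
  if left (sch j) is _.+1 then q (a (used (sch j))) else Z (time (sch j)).
have /choice[x xP] a := MP (z a) seg.
have {}xP a j i : (i <= seg j)%N ->
    torus_norm (iter (time (sch j) + i) T (x a) - iter i T (z a j)) <= Num.min eps eps1.
  by move=> /xP; rewrite start_schedule.
exists x; split => [a cA|n]; last first.
  have [j jn nj] := schedule_density n0 M0 K pick n.
  exists (used (sch j)) => // c /used_schedule[j' j'j [segj' usedj' leftj']].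
  exists (time (sch j')).
    apply: leq_trans jn; apply: leq_trans (time_schedule_homo n0 M0 K pick j'j).
    by rewrite -!start_schedule /= segj' leq_addr.
  move=> a i /ltnW; rewrite -{1}segj' => /(xP a).
  rewrite /z; case: (left (sch j')) leftj' => // _ _; rewrite /sch usedj' => H.
  by apply: (le_trans H); rewrite ge_min lexx.
pose D : R := (2 * rate n0 M)%:R.
have D0 : 0 < 2 * D + 1 by rewrite ltr_wpDl// mulr_ge0.
(* A window of length [l] starting at [s <= D * l] is a difference of two sums from time 0, with
   total error at most [zeta * (2 * D + 1) * l], that is [e0 / 8 * l]. *)
pose zeta := e0 / 8 / (2 * D + 1).
have zeta0 : 0 < zeta by rewrite !divr_gt0.
have /cvgrPdist_lt/(_ _ zeta0)[n1 _ n1P] := cA.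
set lm := lim _ in n1P.
have PhiP n : (n1 <= n)%N -> `|Phi n (w, x a) - lm * n%:R| <= zeta * n%:R.
  move=> n1n; have [->|n0'] := posnP n.
    by rewrite !mulr0 subr0 /birkhoff_sum big_ord0 normr0.
  have nR0 : 0 < n%:R :> R by rewrite ltr0n.
  have := ltW (n1P n n1n).
  rewrite /= -/(birkhoff_sum alpha T h phi n (w, x a)) => H.
  rewrite distrC -ler_pdivrMr// -[n%:R^-1](gtr0_norm (_ : 0 < n%:R^-1)) ?invr_gt0//.
  by rewrite -normrM mulrBl mulfK ?lt0r_neq0// mulrC.
have block_end j : (n1 <= j)%N -> left (sch j) = 0%N ->
    `|u (len (sch j)) - lm| <= e0 / 4.
  move=> n1j j0; set l := len _; set s := time (sch j).
  have [Kl [_]] := time_schedule_len n0 M0 K pickP j.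
  rewrite -/sch j0 addn0 -/l -/s => sl.
  have l0 : 0 < l%:R :> R by rewrite ltr0n (leq_trans K0).
  have n1s : (n1 <= s)%N by exact: leq_trans n1j (time_schedule_ge n0 M0 K pick j).
  have := PhiP _ n1s; have := PhiP _ (leq_trans n1s (leq_addr l s)).
  rewrite birkhoff_sumD natrD => P1 P2.
  have P3 : `|Phi l (iter s Theta (w, x a)) - Phi l p| <= e0 / 16 * l%:R + C.
    apply: ZP => i il; have : (i <= seg j)%N by rewrite /seg /segment -/sch j0 ltnW.
    by move=> /(xP a); rewrite /z j0 => /le_trans; apply; rewrite ge_min lexx orbT.
  have P4 := KP l Kl.
  have sD : s%:R <= l%:R * D by rewrite -natrM ler_nat.
  have P5 : zeta * (s%:R + l%:R) + zeta * s%:R <= e0 / 8 * l%:R.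
    have -> : e0 / 8 * l%:R = zeta * (2 * (l%:R * D) + l%:R).
      by rewrite /zeta; field; rewrite lt0r_neq0.
    by rewrite -mulrDr ler_pM2l//; lra.
  have -> : u l - lm = (Phi l p - lm * l%:R) / l%:R.
    by rewrite mulrBl mulfK ?lt0r_neq0// mulrC.
  rewrite normrM [X in _ * X]gtr0_norm ?invr_gt0// ler_pdivrMr//.
  move: P1 P2 P3; set A := Phi s _; set B := Phi l _; set E := Phi l p.
  rewrite !ler_norml => /andP[? ?] /andP[? ?] /andP[? ?]; apply/andP; split; lra.
(* Two successive windows past [n1] are each within [e0 / 4] of the limit, against the oscillation
   [e0]. *)
have [j1 [n1j1 j10 _]] := schedule_reaches_block_end n0 M K pick n1.
have [L lenL] := schedule_next_block j10.
have [j2 [j12 j20 lenj2]] := schedule_reaches_block_end n0 M K pick j1.+1.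
have := block_end j1 n1j1 j10; have := block_end j2 (leq_trans n1j1 (ltnW j12)) j20.
rewrite /sch lenj2 lenL; have [_ /=] := pickP' (len (schedule n0 M K pick j1), L).
rewrite -/(pick _ L) => H1 H2 H3.
have := le_trans H1 (ler_distD lm _ _); rewrite [X in _ + X]distrC; lra.
Qed.

(** Two coded points in one Bowen ball of radius [e / 4] share their first choices, since distinct
    choices are [e] apart and shadowing costs [e / 8] for each. A cover of too small a sum would
    thus give a cylinder cover of total mass below 1. *)
Lemma bowen_entropy_irregular_ge w : irregular_set Theta phi !=set0 ->
  (topological_entropy T <=
    bowen_entropy T [set x | irregular_set Theta phi (w, x)])%E.
Proof.
move=> [p pI]; apply: lee_by_lt => g gT; apply: lee_by_lt => s.
rewrite lte_fin => sg.
have [e e0 gr] := lt_lim_growth gT.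
have e40 : 0 < e / 4 by rewrite divr_gt0.
rewrite /bowen_entropy at_right_limE; last exact: bowen_entropy_at_nonincreasing.
apply: le_trans (ereal_sup_ubound (ex_intro2 _ _ (e / 4) e40 erefl)).
apply: le_ereal_inf_tmp => _ [s1 /bowen_measure_eq0/(_ 0%N) s10 <-].
rewrite lee_fin leNgt; apply/negP => s1s.
have e80 : 0 < e / 8 by rewrite divr_gt0.
have e4 : e / 8 + (e / 4 + (e / 4 + e / 8)) <= e by lra.
have [M MP] := irregular_shadowing_codes w pI e80.
have gs1 : 0 < g - s1 by lra.
(* For [n0] beyond [N1], the gap and the extra unit in [Q = n0 + M + 1] cost less than
   [(g - s1) * n0]. *)
have [N1 [_ N1P]] := natr_dominates (s1 * M.+1%:R) gs1.
have [n0 N1n0 [m gm [q qP]]] := gr N1.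
have m0 : (0 < m)%N by rewrite -(ltr0n R) (lt_le_trans (expR_gt0 _) gm).
have [x [xI xP]] := MP n0 m q.
(* [s2] replaces a negative [s1] by 0, so that the estimates are monotone in the order of the
   balls. *)
pose Q := (n0 + M).+1; pose s2 := Num.max s1 0.
have s20 : 0 <= s2 by rewrite le_max lexx orbT.
have mQ : expR (s2 * Q%:R) <= m%:R.
  rewrite /s2; have [s1n|s1p] := leP s1 0.
    by rewrite mul0r expR0 ler1n.
  apply: le_trans gm; rewrite ler_expR.
  have := N1P n0 N1n0; rewrite /Q -addnS natrD; lra.
(* The threshold [exp (- s2 Q)] makes up for the last free segment, which a ball may see only in
   part. *)
have : (bowen_sum T [set x | irregular_set Theta phi (w, x)] s1 0 (e / 4) <
    (expR (- (s2 * Q%:R)))%:E)%E.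
  by rewrite s10 lte_fin expR_gt0.
move=> /ereal_inf_lt[_ [I [n [y [_ cov ->]]]]].
have /choice[d dP] i : exists d, (n i <= Q * d.+1)%N /\ forall c, (c < d)%N ->
    exists2 t, (t + n0 <= n i)%N & forall a k, (k < n0)%N ->
      torus_norm (iter (t + k) T (x a) - iter k T (q (a c))) <= e / 8.
  by have [d ? ?] := xP (n i); exists d.
pose B i := [set a | bowen_ball T (n i) (y i) (e / 4) (x a)].
apply/negP; rewrite -leNgt.
suff H : (1 <= (expR (s2 * Q%:R))%:E *
    \esum_(i in I) (expR (- (s1 * (n i)%:R)))%:E)%E.
  move: H; set S := (\esum_(i in I) _)%E => H.
  have -> : S = ((expR (- (s2 * Q%:R)))%:E * ((expR (s2 * Q%:R))%:E * S))%E.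
    by rewrite muleA -EFinM -expRD addNr expR0 mul1e.
  rewrite -[X in (X <= _)%E]mule1; exact: lee_wpmul2l.
have dQ i : (n i <= Q * (d i).+1)%N by have [] := dP i.
apply: (@cylinder_cover _ m m0 I d B (expR (s2 * Q%:R))) => //.
- move=> i Ii; have mR0 : 0 < m%:R :> R by rewrite ltr0n.
  apply: (@le_trans _ _ (expR (- (s2 * Q%:R)) ^+ d i)).
    rewrite -exprVn lerXn2r ?nnegrE ?invr_ge0 ?expR_ge0//.
    by rewrite expRN lef_pV2 ?posrE ?expR_gt0.
  rewrite -expRM_natr -expRD ler_expR.
  have s12 : s1 * (n i)%:R <= s2 * (n i)%:R by rewrite ler_wpM2r// le_max lexx.
  have : s2 * (n i)%:R <= s2 * (Q%:R * (d i)%:R + Q%:R).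
    by rewrite ler_wpM2l// -natrM -natrD ler_nat addnC -mulnS.
  lra.
- move=> i a a' c Ii Ba Ba' cd; have [_ /(_ c cd)[t tn tP]] := dP i.
  apply/eqP/negPn/negP => /qP/(bowen_distP _ _ _ _ (ltW e0))[k kn0].
  have close b : B i b ->
      mdist (iter (t + k) T (x b)) (iter (t + k) T (y i)) < e / 4.
    rewrite /B /= /bowen_ball /= => H; rewrite metric_sym; apply: le_lt_trans H.
    have tk : (t + k < n i)%N by rewrite (leq_trans _ tn)// ltn_add2l.
    exact: (le_bigmax _ (fun j : 'I_(n i) =>
      mdist (iter j T (y i)) (iter j T (x b))) (Ordinal tk)).
  set X := iter k T (q (a c)); set X' := iter k T (q (a' c)).
  set A := iter (t + k) T (x a); set A' := iter (t + k) T (x a').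
  set Y := iter (t + k) T (y i).
  have H : mdist X X' <= e / 8 + (e / 4 + (e / 4 + e / 8)).
    apply: (le_trans (metric_triangle X A X')); apply: lerD.
      by rewrite metric_sym torus_distE; exact: tP.
    apply: (le_trans (metric_triangle A Y X')); apply: lerD; first exact/ltW/close.
    apply: (le_trans (metric_triangle Y A' X')); apply: lerD.
      by rewrite metric_sym; exact/ltW/close.
    by rewrite torus_distE; exact: tP.
  move=> /lt_le_trans/(_ H); by rewrite ltNge e4.
- move=> a; have [i Ii Bi] := cov _ (xI a); by exists i.
Qed.

End moran.

(** * Entropy equalities and residuality, fiber by fiber *)

Unset Implicit Arguments.

Theorem corollary4 (R : realType) (alpha : R) (T : torus R -> torus R)
    (h : circle R -> torus R) (phi : circle R * torus R -> R)
    (alpha_irrational : irrational alpha)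
    (T_hyperbolic : hyperbolic_toral_automorphism T)
    (h_continuous : continuous h)
    (phi_continuous : continuous phi)
    (Theta := skew_product alpha T h)
    (I_phi := irregular_set Theta phi)
    (I_phi_nonempty : I_phi !=set0) :
  {ae @circle_lebesgue R, forall w : circle R,
    let I_phi_w := [set x : torus R | I_phi (w, x)] in
    (bowen_entropy T I_phi_w
       = fiber_entropy (@circle_lebesgue R) (rotation alpha) (fiber_map T h) /\
     fiber_entropy (@circle_lebesgue R) (rotation alpha) (fiber_map T h)
       = topological_entropy Theta) /\
    residual I_phi_w}.
Proof.
have [sp _] := hyperbolic_splitting T_hyperbolic.
apply: aeW => w; split; [split|].
- rewrite (fiber_entropyE alpha sp); apply/eqP; rewrite eq_le; apply/andP; split.
    exact: bowen_entropy_le (0 : torus R).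
  exact: (bowen_entropy_irregular_ge sp).
- rewrite (fiber_entropyE alpha sp).
  exact: (topological_entropy_skew_product sp).
- exact: (irregular_fiber_residual sp).
Qed.
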